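(* Let $\Omega$ be a nc set, $\mathcal A$ a unital $C^*$-algebra, $\mathcal U,\mathcal Y$ Hilbert spaces. Let $K'\colon\Omega\times\Omega\to\mathcal L(\mathcal A,\mathcal L(\mathcal U))_{\rm nc}$ and $K\colon\Omega\times\Omega\to\mathcal L(\mathcal A,\mathcal L(\mathcal Y))_{\rm nc}$ be two cp global (respectively cp nc) kernels and let $S\colon\Omega\to\mathcal L(\mathcal U,\mathcal Y)_{\rm nc}$ be a global (respectively nc) function which is a contractive multiplier from $\mathcal H(K')$ to $\mathcal H(K)$. Then the global/nc reproducing kernel Hilbert space $\mathcal H(K_S)$ associated with the cp global/nc kernel $$K_S(Z,W)(P)=K(Z,W)(P)-S(Z)K'(Z,W)(P)S(W)^*$$ is isometrically equal to the pull-back space $\operatorname{Ran}(I-M_SM_S^* )^{1/2}\subset\mathcal H(K)$ with norm $$\|(I-M_SM_S^* )^{1/2}h\|_{\mathcal H(K_S)}=\|Qh\|_{\mathcal H(K)},$$ where $Q\colon\mathcal H(K)\to(\operatorname{Ker}(I-M_SM_S^* )^{1/2})^\perp$ is the orthogonal projection. Equivalently, $\mathcal H(K_S)$ is the Brangesian complement of the Hilbert space $\mathcal M_{M_S}$ contractively included in $\mathcal H(K)$ defined by $\mathcal M_{M_S}=\operatorname{Ran}M_S$ with pull-back norm $$\|M_Sg\|_{\mathcal M_{M_S}}=\|Q'g\|_{\mathcal H(K')},$$ where $Q'\colon\mathcal H(K')\to(\operatorname{Ker}M_S)^\perp$ is the orthogonal projection. The space $\mathcal M_{M_S}$ is itself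 a global/nc reproducing kernel Hilbert space with reproducing kernel $$K_S^0(Z,W)(P)=S(Z)\,K'(Z,W)(P)\,S(W)^*.$$
   Context: For a set $\mathcal S$, $\mathcal S_{\rm nc}=\coprod_{n\ge1}\mathcal S^{n\times n}$; $\Omega\subset\mathcal S_{\rm nc}$ is a nc set if closed under direct sums $(Z,W)\mapsto\begin{bmatrix}Z&0\\0&W\end{bmatrix}$; $\Omega_n=\Omega\cap\mathcal S^{n\times n}$. In the nc case $\mathcal S=\mathcal V$ is a complex vector space. $\mathcal L(\mathcal X,\mathcal Y)$ denotes bounded linear operators, $\mathcal L(\mathcal X,\mathcal Y)^{n\times n}\cong\mathcal L(\mathcal X^n,\mathcal Y^n)$. A function $f\colon\Omega\to\mathcal L(\mathcal X,\mathcal Y)_{\rm nc}$ is a global function if it is graded ($f(Z)\in\mathcal L(\mathcal X,\mathcal Y)^{n\times n}$ for $Z\in\Omega_n$) and $f\left(\begin{bmatrix}Z&0\\0&W\end{bmatrix}\right)=\begin{bmatrix}f(Z)&0\\0&f(W)\end{bmatrix}$; a nc function if it is graded and $\alpha Z=\widetilde Z\alpha$ ($Z\in\Omega_n$, $\widetilde Z\in\Omega_m$, $\alpha\in\mathbb C^{m\times n}$) implies $\alpha f(Z)=f(\widetilde Z)\alpha$. A function $K\colon\Omega\times\Omega\to\mathcal L(\mathcal A,\mathcal L(\mathcal Y))_{\rm nc}$ is graded if for $Z\in\Omega_n$, $W\in\Omega_m$, $K(Z,W)$ is a linear map $\mathcal A^{n\times m}\to\mathcal L(\mathcal Y)^{n\times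 m}\cong\mathcal L(\mathcal Y^m,\mathcal Y^n)$. It is a global kernel if graded and $$K\left(\begin{bmatrix}Z&0\\ 0&\widetilde Z\end{bmatrix},\begin{bmatrix}W&0\\ 0&\widetilde W\end{bmatrix}\right)\left(\begin{bmatrix}P_{11}&P_{12}\\ P_{21}&P_{22}\end{bmatrix}\right)=\begin{bmatrix}K(Z,W)(P_{11})&K(Z,\widetilde W)(P_{12})\\ K(\widetilde Z,W)(P_{21})&K(\widetilde Z,\widetilde W)(P_{22})\end{bmatrix};$$ a nc kernel if graded and $\alpha Z=\widetilde Z\alpha$, $\beta W=\widetilde W\beta$ ($\alpha\in\mathbb C^{\tilde n\times n}$, $\beta\in\mathbb C^{\tilde m\times m}$), $P\in\mathcal A^{n\times m}$ imply $\alpha K(Z,W)(P)\beta^*=K(\widetilde Z,\widetilde W)(\alpha P\beta^* )$. A global/nc kernel is cp if $K(Z,Z)(P)\succeq0$ whenever $Z\in\Omega_n$, $P\succeq0$ in $\mathcal A^{n\times n}$, $n\in\mathbb N$. $\mathcal A^n$ denotes columns, $\mathcal A^{1\times m}$ rows over $\mathcal A$; $v^*$ is conjugate transpose. For a cp global (nc) kernel $K$, the global (nc) reproducing kernel Hilbert space $\mathcal H(K)$ is the unique Hilbert space of global (nc) functions $f\colon\Omega\to\mathcal L(\mathcal A,\mathcal Y)_{\rm nc}$ such that: (a) for $W\in\Omega_m$, $v\in\mathcal A^{1\times m}$, $y\in\mathcal Y^m$ the function $K_{W,v,y}(Z)u=K(Z,W)(uv)y$ ($Z\in\Omega_n$,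 $u\in\mathcal A^n$) belongs to $\mathcal H(K)$; (b) $\langle f(W)(v^* ),y\rangle_{\mathcal Y^m}=\langle f,K_{W,v,y}\rangle_{\mathcal H(K)}$ for all $f\in\mathcal H(K)$; (c) $(\sigma(a)f)(W)(v^* )=f(W)(v^*a)$ defines a unital $*$-representation $\sigma$ of $\mathcal A$ on $\mathcal H(K)$. $S$ is a contractive multiplier from $\mathcal H(K')$ to $\mathcal H(K)$ if $M_S\colon f\mapsto(W\mapsto S(W)f(W))$ maps $\mathcal H(K')$ into $\mathcal H(K)$ with operator norm at most $1$; in this case $K_S$ is a cp global/nc kernel. A Hilbert space $\mathcal K$ is contractively included in a Hilbert space $\mathcal H$ if $\mathcal K\subset\mathcal H$ as vector spaces and $\|k\|_{\mathcal H}\le\|k\|_{\mathcal K}$ for $k\in\mathcal K$. Its Brangesian complement is the Hilbert space $\mathcal K^{\perp_{\rm dBR}}=\{h\in\mathcal H\colon\|h\|^2_{\mathcal K^{\perp_{\rm dBR}}}:=\sup\{\|h+k\|^2_{\mathcal H}-\|k\|^2_{\mathcal K}\colon k\in\mathcal K\}<\infty\}$. *)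

(* Defs.v *)
From HB Require Import structures.
From mathcomp Require Import all_boot all_order all_algebra complex.
From mathcomp Require Import all_classical all_reals ereal topology normedtype.

Set Implicit Arguments.
Unset Strict Implicit.
Unset Printing Implicit Defensive.

Import Order.TTheory GRing.Theory Num.Theory.
Import numFieldNormedType.Exports.

Local Open Scope classical_set_scope.
Local Open Scope ring_scope.

(* The scalars are the complex numbers R[i] over R : realType; the norm of a
   normedModType R[i] takes its values in R[i] as well. *)

(* [dotp] is linear in its first argument, conjugate-linear in its second. *)
HB.mixin Record isHilbert (R : realType) H of CompleteNormedModule R[i] H := {
  dotp : {dot H for Num.conj};
  sqr_norm_dotp : forall x : H, `|x| ^+ 2 = dotp x x
}.

#[short(type="hilbertType")]
HB.structure Definition Hilbert (R : realType) :=
  {H of CompleteNormedModule R[i] H & isHilbert R H}.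

(* Unital C*-algebras.  The product is a field of its own because the
   hierarchy has no common child of rings and of normed modules over R[i]
   other than numDomainType. *)
HB.mixin Record isCStar (R : realType) A of CompleteNormedModule R[i] A := {
  cmul : A -> A -> A;
  cone : A;
  star : A -> A;
  cmulA : associative cmul;
  cmul1x : left_id cone cmul;
  cmulx1 : right_id cone cmul;
  cmulDl : left_distributive cmul +%R;
  cmulDr : right_distributive cmul +%R;
  cmulZl : forall (c : R[i]) (x y : A), cmul (c *: x) y = c *: cmul x y;
  cmulZr : forall (c : R[i]) (x y : A), cmul x (c *: y) = c *: cmul x y;
  cmul_norm : forall x y : A, `|cmul x y| <= `|x| * `|y|;
  starK : involutive star;
  starD : {morph star : x y / x + y};
  starZ : forall (c : R[i]) (x : A), star (c *: x) = c^* *: star x;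
  starM : forall x y : A, star (cmul x y) = cmul (star y) (star x);
  cstar_identity : forall x : A, `|cmul (star x) x| = `|x| ^+ 2
}.

#[short(type="cstarType")]
HB.structure Definition CStar (R : realType) :=
  {A of CompleteNormedModule R[i] A & isCStar R A}.

Definition adjmx (R : realType) (A : cstarType R) n m
    (P : 'M[A]_(n, m)) : 'M[A]_(m, n) :=
  \matrix_(i, j) star (P j i).

Definition mulcmx (R : realType) (A : cstarType R) n k m
    (P : 'M[A]_(n, k)) (P' : 'M[A]_(k, m)) : 'M[A]_(n, m) :=
  \matrix_(i, j) \sum_l cmul (P i l) (P' l j).

(* Positive elements of a C*-algebra, here that of n x n matrices over A, are
   those of the form X^* X. *)
Definition posmx (R : realType) (A : cstarType R) n (P : 'M[A]_n) : Prop :=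
  exists X : 'M[A]_n, P = mulcmx (adjmx X) X.

Definition bounded_linear (R : realType) (X Y : normedModType R[i])
    (T : X -> Y) : Prop :=
  linear T /\ exists M : R[i], forall x, `|T x| <= M * `|x|.

(* The following are picked by choice among the elements with their defining
   property; that element exists and is unique, respectively, for T a bounded
   operator, for T a positive bounded operator, and for N a closed subspace. *)
Section HilbertOperators.
Variables (R : realType) (H1 H2 : hilbertType R).

Definition adj (T : H1 -> H2) (y : H2) : H1 :=
  xget 0 [set x' : H1 | forall x, dotp (T x) y = dotp x x'].

Definition psqrt (T : H1 -> H1) : H1 -> H1 :=
  xget (fun=> 0) [set D : H1 -> H1 |
    [/\ bounded_linear D, forall x, 0 <= dotp (D x) x & D \o D = T]].

Definition orthc (N : set H1) : set H1 :=
  [set x | forall y, N y -> dotp x y = 0].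

Definition orthproj (N : set H1) (x : H1) : H1 :=
  xget 0 [set p | N p /\ orthc N (x - p)].

Definition opker (T : H1 -> H2) : set H1 := [set x | T x = 0].

End HilbertOperators.

(* Elements of L(X, Y)^(n x m) are matrices of functions X -> Y, boundedness
   and linearity of the entries being part of gradedness below. *)

Section Matrices.
Variable R : realType.

(* The products alpha Z and Z beta; V may be a space X -> Y of functions, for
   which the vector space operations are pointwise. *)
Definition lact (V : lmodType R[i]) p n m
    (alpha : 'M[R[i]]_(p, n)) (Z : 'M[V]_(n, m)) : 'M[V]_(p, m) :=
  \matrix_(i, j) \sum_k alpha i k *: Z k j.

Definition ract (V : lmodType R[i]) n m q
    (Z : 'M[V]_(n, m)) (beta : 'M[R[i]]_(m, q)) : 'M[V]_(n, q) :=
  \matrix_(i, j) \sum_k beta k j *: Z i k.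

Definition ctmx n m (beta : 'M[R[i]]_(n, m)) : 'M[R[i]]_(m, n) :=
  map_mx Num.conj beta^T.

Definition mxapp (X : Type) (Y : nmodType) n m
    (T : 'M[X -> Y]_(n, m)) (u : 'cV[X]_m) : 'cV[Y]_n :=
  \col_i \sum_j T i j (u j 0).

Definition mxcomp (X Y : Type) (W : nmodType) n k m
    (T : 'M[Y -> W]_(n, k)) (T' : 'M[X -> Y]_(k, m)) : 'M[X -> W]_(n, m) :=
  \matrix_(i, j) (fun x => \sum_l T i l (T' l j x)).

Definition mxadj (X Y : hilbertType R) n m
    (T : 'M[X -> Y]_(n, m)) : 'M[Y -> X]_(m, n) :=
  \matrix_(i, j) adj (T j i).

Definition coldot (Y : hilbertType R) n (y y' : 'cV[Y]_n) : R[i] :=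
  \sum_i dotp (y i 0) (y' i 0).

Definition posop (Y : hilbertType R) n (T : 'M[Y -> Y]_n) : Prop :=
  forall y : 'cV[Y]_n, 0 <= coldot (mxapp T y) y.

End Matrices.

(* Om n is the set of the n x n matrices in a subset of S_nc; the restriction
   to n >= 1 is part of [nc_set]. *)
Definition ncsubset (T : Type) : Type := forall n, set 'M[T]_n.

(* The direct sum of matrices over a set only makes sense once an element of
   that set plays the role of 0. *)
Inductive nc_setting (R : realType) : Type :=
| GlobalCase (T : Type) (zero : T)
| NcCase (V : lmodType R[i]).

Definition base_set R (s : nc_setting R) : Type :=
  match s with GlobalCase T _ => T | NcCase V => V end.

Definition base_zero R (s : nc_setting R) : base_set s :=
  match s return base_set s with GlobalCase _ z => z | NcCase _ => 0 end.

Definition dsum (T : Type) (zero : T) n m (Z : 'M[T]_n) (W : 'M[T]_m) :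
    'M[T]_(n + m) :=
  block_mx Z (const_mx zero) (const_mx zero) W.

Definition nc_set R (s : nc_setting R) (Om : ncsubset (base_set s)) :
    Prop :=
  Om 0%N = set0 /\
  forall n m (Z : 'M_n) (W : 'M_m),
    Om n Z -> Om m W -> Om (n + m)%N (dsum (base_zero s) Z W).

Section FunctionsAndKernels.
Variables (R : realType) (T : Type) (Om : ncsubset T).
Local Arguments Om : clear implicits.

(* The types already impose the sizes of the values; a set coerces to the type
   of its elements. *)
Definition ncmap (X Y : Type) : Type := forall n, Om n -> 'M[X -> Y]_n.

Definition nckmap (A Y : Type) : Type :=
  forall n m, Om n -> Om m -> 'M[A]_(n, m) -> 'M[Y -> Y]_(n, m).

Definition graded_fun (X Y : normedModType R[i]) (f : ncmap X Y) : Prop :=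
  forall n (Z : Om n) i j, bounded_linear (f n Z i j).

Definition graded_kernel (A Y : normedModType R[i]) (K : nckmap A Y) : Prop :=
  forall n m (Z : Om n) (W : Om m),
    (forall (c : R[i]) (P P' : 'M[A]_(n, m)),
       K n m Z W (map_mx ( *:%R c) P + P') =
       map_mx ( *:%R c) (K n m Z W P) + K n m Z W P') /\
    (forall P i j, bounded_linear (K n m Z W P i j)).

Definition global_fun (zero : T) (X Y : normedModType R[i])
    (f : ncmap X Y) : Prop :=
  graded_fun f /\
  forall n m (Z : Om n) (W : Om m) (ZW : Om (n + m)%N),
    val ZW = dsum zero (val Z) (val W) ->
    f (n + m)%N ZW = block_mx (f n Z) 0 0 (f m W).

Definition global_kernel (zero : T) (A Y : normedModType R[i])
    (K : nckmap A Y) : Prop :=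
  graded_kernel K /\
  forall n n' m m' (Z : Om n) (Z' : Om n') (W : Om m) (W' : Om m')
         (ZZ : Om (n + n')%N) (WW : Om (m + m')%N),
    val ZZ = dsum zero (val Z) (val Z') ->
    val WW = dsum zero (val W) (val W') ->
    forall P11 P12 P21 P22,
      K (n + n')%N (m + m')%N ZZ WW (block_mx P11 P12 P21 P22) =
      block_mx (K n m Z W P11) (K n m' Z W' P12)
               (K n' m Z' W P21) (K n' m' Z' W' P22).

End FunctionsAndKernels.

Section NcFunctionsAndKernels.
Variables (R : realType) (V : lmodType R[i]) (Om : ncsubset V).
Local Arguments Om : clear implicits.

Definition nc_fun (X Y : normedModType R[i]) (f : ncmap Om X Y) : Prop :=
  graded_fun f /\
  forall n m (Z : Om n) (Z' : Om m) (alpha : 'M[R[i]]_(m, n)),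
    lact alpha (val Z) = ract (val Z') alpha ->
    lact alpha (f n Z) = ract (f m Z') alpha.

Definition nc_kernel (A Y : normedModType R[i]) (K : nckmap Om A Y) : Prop :=
  graded_kernel K /\
  forall n n' m m' (Z : Om n) (Z' : Om n') (W : Om m) (W' : Om m')
         (alpha : 'M[R[i]]_(n', n)) (beta : 'M[R[i]]_(m', m)),
    lact alpha (val Z) = ract (val Z') alpha ->
    lact beta (val W) = ract (val W') beta ->
    forall P : 'M[A]_(n, m),
      lact alpha (ract (K n m Z W P) (ctmx beta)) =
      K n' m' Z' W' (lact alpha (ract P (ctmx beta))).

End NcFunctionsAndKernels.

(* "Global (respectively nc)". *)
Definition gnc_fun R (s : nc_setting R) :
    forall (Om : ncsubset (base_set s)) (X Y : normedModType R[i]),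
    ncmap Om X Y -> Prop :=
  match s with
  | GlobalCase T zero => fun Om X Y f => global_fun zero f
  | NcCase V => fun Om X Y f => nc_fun f
  end.

Definition gnc_kernel R (s : nc_setting R) :
    forall (Om : ncsubset (base_set s)) (A Y : normedModType R[i]),
    nckmap Om A Y -> Prop :=
  match s with
  | GlobalCase T zero => fun Om A Y K => global_kernel zero K
  | NcCase V => fun Om A Y K => nc_kernel K
  end.

Definition cp_kernel R (s : nc_setting R) (Om : ncsubset (base_set s))
    (A : cstarType R) (Y : hilbertType R) (K : nckmap Om A Y) : Prop :=
  gnc_kernel K /\
  forall n (Z : Om n) (P : 'M[A]_n), posmx P -> posop (K n n Z Z P).

(* A Hilbert space together with an injective map identifying its elements
   with functions on Om, the vector space operations being pointwise. *)
Record fun_hilbert (R : realType) (T : Type) (Om : ncsubset T)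
    (A : Type) (Y : hilbertType R) := FunHilbert {
  fh_space :> hilbertType R;
  fh_fun : fh_space -> ncmap Om A Y;
  fh_linear : forall n (Z : Om n) i j, linear (fun f => fh_fun f Z i j);
  fh_inj : injective fh_fun
}.

Section ReproducingKernels.
Variables (R : realType) (s : nc_setting R) (Om : ncsubset (base_set s)).
Local Arguments Om : clear implicits.
Variables (A : cstarType R) (Y : hilbertType R).
Implicit Types (K : nckmap Om A Y) (H L B : fun_hilbert Om A Y).

Definition unital_star_rep (H : hilbertType R) (sigma : A -> H -> H) : Prop :=
  [/\ (forall a, bounded_linear (sigma a)) /\ linear sigma,
      sigma cone = id,
      forall a b, sigma (cmul a b) = sigma a \o sigma b &
      forall a f g, dotp (sigma (star a) f) g = dotp f (sigma a g)].

Definition is_rkhs K H : Prop :=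
  [/\ forall f : H, gnc_fun (fh_fun f),
      forall m (W : Om m) (v : 'rV[A]_m) (y : 'cV[Y]_m),
        exists k : H,
          (forall n (Z : Om n) (u : 'cV[A]_n),
             mxapp (fh_fun k Z) u = mxapp (K n m Z W (mulcmx u v)) y) /\
          (forall f : H,
             coldot (mxapp (fh_fun f W) (adjmx v)) y = dotp f k) &
      exists sigma : A -> H -> H,
        unital_star_rep sigma /\
        forall a (f : H) m (W : Om m) (v : 'rV[A]_m),
          mxapp (fh_fun (sigma a f) W) (adjmx v) =
          mxapp (fh_fun f W) (map_mx (fun x => cmul x a) (adjmx v))].

(* L is the range of T : G -> H with the pull-back norm
   |T g|_L = |Q g|_G, Q the orthogonal projection of G onto (Ker T)^perp. *)
Definition is_pullback (G : hilbertType R) H (T : G -> H) L : Prop :=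
  (forall l : L, exists g : G, fh_fun (T g) = fh_fun l) /\
  (forall g : G, exists l : L,
     fh_fun l = fh_fun (T g) /\ `|l| = `|orthproj (orthc (opker T)) g|).

Definition contractively_included L H : Prop :=
  forall l : L, exists h : H, fh_fun h = fh_fun l /\ `|h| <= `|l|.

Definition sqnorm (H : hilbertType R) (x : H) : R :=
  complex.Re (`|x| ^+ 2).

Definition brangesian_sqnorm L H (h : H) : \bar R :=
  ereal_sup [set x | exists (l : L) (l' : H),
    fh_fun l' = fh_fun l /\ x = (sqnorm (h + l') - sqnorm l)%:E].

Definition is_brangesian_complement L H B : Prop :=
  [/\ forall b : B, exists h : H, fh_fun h = fh_fun b,
      forall h : H, (brangesian_sqnorm L h < +oo)%E <->
                    exists b : B, fh_fun b = fh_fun h &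
      forall (b : B) (h : H), fh_fun b = fh_fun h ->
        (sqnorm b)%:E = brangesian_sqnorm L h].

End ReproducingKernels.

Section Multipliers.
Variables (R : realType) (s : nc_setting R) (Om : ncsubset (base_set s)).
Local Arguments Om : clear implicits.
Variables (A : cstarType R) (U Y : hilbertType R).

Definition contractive_multiplier (S : ncmap Om U Y)
    (H' : fun_hilbert Om A U) (H : fun_hilbert Om A Y) (M : H' -> H) : Prop :=
  (forall (f : H') n (W : Om n),
     fh_fun (M f) W = mxcomp (S n W) (fh_fun f W)) /\
  (forall f : H', `|M f| <= `|f|).

Definition KS0 (K' : nckmap Om A U) (S : ncmap Om U Y) : nckmap Om A Y :=
  fun n m Z W P =>
    mxcomp (mxcomp (S n Z) (K' n m Z W P)) (mxadj (S m W)).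

Definition KS (K : nckmap Om A Y) (K' : nckmap Om A U) (S : ncmap Om U Y) :
    nckmap Om A Y :=
  fun n m Z W P => K n m Z W P - KS0 K' S Z W P.

Definition defect (H' H : hilbertType R) (M : H' -> H) : H -> H :=
  psqrt (fun h => h - M (adj M h)).

End Multipliers.

(* Main.v *)
(* Every space in sight is the range of a bounded operator B into H(K), with
   the norm of (Ker B)^perp.  If the evaluation functionals, composed with B,
   are represented in the domain of B by vectors g, then the functions B g are
   the kernel functions of that range space.  For B = M_S the vector is the
   kernel function of K' at S(W)^* y, which gives the kernel K_S^0; since this
   vector is also M_S^* applied to the kernel function k of K, the operator
   B = (I - M_S M_S^* )^(1/2) has g = B k and B g = k - M_S M_S^* k, which
   gives the kernel K_S.  A space is determined by its reproducing kernel, so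
   H(K_S) is this range.

   For the Brangesian complement put D = (I - M_S M_S^* )^(1/2).  The row
   [D M_S] has an isometric adjoint, so |D d + M_S g|^2 - |g|^2 <= |d|^2, with
   near equality for g = M_S^* x and D x close to d.  Conversely, if
   |h + M_S g|^2 - |g|^2 is bounded in g, the choice g = M_S^* x bounds
   2 Re <x, h> - |D x|^2, and Riesz representation on Ran D gives h in Ran D.

   Riesz representation, orthogonal projections, the uniqueness of the space
   with a given kernel and the last step above are all instances of
   [riesz_relation]. *)

Require Import Defs.
From HB Require Import structures.
From mathcomp Require Import all_boot all_order all_algebra complex.
From mathcomp Require Import all_classical all_reals ereal topology normedtype.
From mathcomp Require Import ring lra.

Set Implicit Arguments.
Unset Strict Implicit.
Unset Printing Implicit Defensive.

Import Order.TTheory GRing.Theory Num.Theory.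
Import numFieldNormedType.Exports.

Local Open Scope classical_set_scope.
Local Open Scope ring_scope.
Local Open Scope complex_scope.

(** * Real inner product and norm *)

Section InnerProduct.
Variables (R : realType) (H : hilbertType R).
Implicit Types (x y z : H) (a : R[i]).

(** Norms and products take values in [R[i]]; their real parts allow estimates by real arithmetic.
    Nothing is lost, since [Im_dotp] reads the imaginary part off a product with ['i *: y]. *)
Definition rdot x y : R := complex.Re (dotp x y).

Definition rnorm x : R := complex.Re `|x|.

Lemma dotpDl x y z : dotp (x + y) z = dotp x z + dotp y z.
Proof. exact: linearDl. Qed.

Lemma dotpDr x y z : dotp x (y + z) = dotp x y + dotp x z.
Proof. exact: linearDr. Qed.

Lemma dotpZl a x y : dotp (a *: x) y = a * dotp x y.
Proof. by rewrite linearZl_LR. Qed.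

Lemma dotpZr a x y : dotp x (a *: y) = a^* * dotp x y.
Proof. by rewrite linearZr_LR. Qed.

Lemma dotpC x y : dotp x y = (dotp y x)^*.
Proof. by rewrite hermC /= expr0 mul1r. Qed.

Lemma dotp0l y : dotp 0 y = 0.
Proof. exact: linear0l. Qed.

Lemma dotp0r y : dotp y 0 = 0.
Proof. exact: linear0r. Qed.

Lemma dotpNl x y : dotp (- x) y = - dotp x y.
Proof. exact: linearNl. Qed.

Lemma dotpNr x y : dotp x (- y) = - dotp x y.
Proof. exact: linearNr. Qed.

Lemma dotpBl x y z : dotp (x - y) z = dotp x z - dotp y z.
Proof. exact: linearBl. Qed.

Lemma dotpBr x y z : dotp x (y - z) = dotp x y - dotp x z.
Proof. exact: linearBr. Qed.

Lemma Im_dotp x y : complex.Im (dotp x y) = rdot x ('i *: y).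
Proof.
by rewrite /rdot dotpZr; case: (dotp x y) => a b /=; ring.
Qed.

Lemma rdotC x y : rdot x y = rdot y x.
Proof. by rewrite /rdot dotpC; case: (dotp y x). Qed.

Lemma rdotDl x y z : rdot (x + y) z = rdot x z + rdot y z.
Proof. by rewrite /rdot dotpDl raddfD. Qed.

Lemma rdotDr x y z : rdot z (x + y) = rdot z x + rdot z y.
Proof. by rewrite /rdot dotpDr raddfD. Qed.

Lemma rdotNl x z : rdot (- x) z = - rdot x z.
Proof. by rewrite /rdot dotpNl raddfN. Qed.

Lemma rdotNr x z : rdot z (- x) = - rdot z x.
Proof. by rewrite /rdot dotpNr raddfN. Qed.

Lemma rdotZl (t : R) x y : rdot (t%:C *: x) y = t * rdot x y.
Proof. by rewrite /rdot dotpZl; case: (dotp x y) => a b /=; ring. Qed.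

Lemma rdotZr (t : R) x y : rdot x (t%:C *: y) = t * rdot x y.
Proof. by rewrite rdotC rdotZl rdotC. Qed.

Lemma rdot0l x : rdot 0 x = 0.
Proof. by rewrite /rdot dotp0l. Qed.

Lemma rdotxx x : rdot x x = sqnorm x.
Proof. by rewrite /rdot -sqr_norm_dotp. Qed.

Lemma normC_rnorm x : `|x| = (rnorm x)%:C.
Proof. by rewrite /rnorm RRe_real // ger0_real. Qed.

Lemma rnorm_ge0 x : 0 <= rnorm x.
Proof. by rewrite -ler0c -normC_rnorm. Qed.

Lemma sqnormE x : sqnorm x = rnorm x ^+ 2.
Proof. by rewrite /sqnorm normC_rnorm -rmorphXn. Qed.

Lemma dotpxx x : dotp x x = (sqnorm x)%:C.
Proof. by rewrite -sqr_norm_dotp normC_rnorm -rmorphXn -sqnormE. Qed.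

Lemma sqnorm_ge0 x : 0 <= sqnorm x.
Proof. by rewrite sqnormE sqr_ge0. Qed.

Lemma sqnorm_eq0 x : sqnorm x = 0 -> x = 0.
Proof.
rewrite sqnormE => /eqP; rewrite sqrf_eq0 => /eqP x0.
by apply/normr0_eq0; rewrite normC_rnorm x0.
Qed.

Lemma sqnormD x y : sqnorm (x + y) = sqnorm x + 2 * rdot x y + sqnorm y.
Proof. by rewrite -!rdotxx !rdotDl !rdotDr (rdotC y x); ring. Qed.

Lemma sqnormB x y : sqnorm (x - y) = sqnorm x - 2 * rdot x y + sqnorm y.
Proof.
by rewrite -!rdotxx !(rdotDl, rdotDr, rdotNl, rdotNr) (rdotC y x); ring.
Qed.

Lemma sqnormN x : sqnorm (- x) = sqnorm x.
Proof. by rewrite -!rdotxx rdotNl rdotNr opprK. Qed.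

Lemma sqnormZ (t : R) x : sqnorm (t%:C *: x) = t ^+ 2 * sqnorm x.
Proof. by rewrite -!rdotxx rdotZl rdotZr mulrA expr2. Qed.

Lemma rnormD x y : rnorm (x + y) <= rnorm x + rnorm y.
Proof. by rewrite -lecR rmorphD /= -!normC_rnorm ler_normD. Qed.

Lemma rnormN x : rnorm (- x) = rnorm x.
Proof. by rewrite /rnorm normrN. Qed.

Lemma rnorm0 : rnorm (0 : H) = 0.
Proof. by rewrite /rnorm normr0. Qed.

Lemma rnormBC x y : rnorm (x - y) = rnorm (y - x).
Proof. by rewrite -rnormN opprB. Qed.

Lemma rnormZ (t : R) x : rnorm (t%:C *: x) = `|t| * rnorm x.
Proof.
rewrite /rnorm normrZ normC_rnorm normc_def /= expr0n addr0 sqrtr_sqr.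
by rewrite mul0r subr0.
Qed.

Lemma rnorm_eq0 x : rnorm x = 0 -> x = 0.
Proof. by move=> x0; apply: sqnorm_eq0; rewrite sqnormE x0 expr0n. Qed.

(** Cauchy-Schwarz: expand the squared norm of [|y| x - |x| y] and divide by [|x| |y|]. *)
Lemma rdot_le_rnorm x y : rdot x y <= rnorm x * rnorm y.
Proof.
have [/rnorm_eq0 ->|y0] := eqVneq (rnorm y) 0.
  by rewrite rdotC rdot0l rnorm0 mulr0.
have y_gt0 : 0 < rnorm y by rewrite lt_neqAle eq_sym y0 rnorm_ge0.
have [/rnorm_eq0 ->|x0] := eqVneq (rnorm x) 0.
  by rewrite rdot0l rnorm0 mul0r.
have x_gt0 : 0 < rnorm x by rewrite lt_neqAle eq_sym x0 rnorm_ge0.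
have := sqnorm_ge0 ((rnorm y)%:C *: x - (rnorm x)%:C *: y).
rewrite sqnormB !sqnormZ rdotZl rdotZr !sqnormE => h.
rewrite -subr_ge0 -(pmulr_rge0 _ (mulr_gt0 x_gt0 y_gt0)); nra.
Qed.

Lemma dotp_ext x y : (forall z, dotp z x = dotp z y) -> x = y.
Proof.
move=> xy; apply/subr0_eq/sqnorm_eq0.
by rewrite -rdotxx /rdot dotpBr xy subrr.
Qed.

End InnerProduct.

Section TwoSpaces.
Variables (R : realType) (H H' : hilbertType R).
Implicit Types (x y : H) (z w : H').

Lemma eq_dotp x y z w :
  rdot x y = rdot z w -> rdot x ('i *: y) = rdot z ('i *: w) ->
  dotp x y = dotp z w.
Proof.
move=> rexy imxy; apply/eqP; rewrite eq_complex; apply/andP; split; apply/eqP.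
  exact: rexy.
by rewrite !Im_dotp.
Qed.

Lemma ler_rnorm x z (c : R) : 0 <= c ->
  (rnorm x <= c * rnorm z) = (sqnorm x <= c ^+ 2 * sqnorm z).
Proof.
move=> c0; rewrite !sqnormE -exprMn ler_sqr // ?nnegrE ?mulr_ge0 //;
exact: rnorm_ge0.
Qed.

Lemma normC_le x z : (`|x| <= `|z|) = (sqnorm x <= sqnorm z).
Proof.
by rewrite !normC_rnorm lecR -(mul1r (rnorm z)) ler_rnorm // expr1n mul1r.
Qed.

Lemma eq_normC x z : (`|x| = `|z|) <-> (sqnorm x = sqnorm z).
Proof.
split=> [xz|]; first by rewrite /sqnorm xz.
rewrite !sqnormE => /eqP; rewrite eqrXn2 ?rnorm_ge0 // => /eqP xz.
by rewrite !normC_rnorm xz.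
Qed.

End TwoSpaces.

(** * Sequential convergence and completeness *)

Section Limits.
Variables (R : realType) (H : hilbertType R).
Implicit Types (u : nat -> H) (p x : H).

Definition tends u p := forall e : R, 0 < e ->
  exists N, forall n, (N <= n)%N -> rnorm (u n - p) < e.

Lemma hilbert_complete u :
  (forall e : R, 0 < e -> exists N, forall n m, (N <= n)%N -> (N <= m)%N ->
     rnorm (u n - u m) < e) -> exists p, tends u p.
Proof.
move=> uC; have cu : cauchy (u @ \oo).
  apply/cauchyP => e e0; have ReR : (complex.Re e)%:C = e.
    by rewrite RRe_real // gtr0_real.
  have Re0 : 0 < complex.Re e by rewrite -ltcR ReR.
  have [N uN] := uC _ Re0; exists (u N).
  exists N => // n /= Nn.
  by rewrite -ball_normE /= normC_rnorm -ReR ltcR; apply: uN.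
have /cvg_ballP up : u @ \oo --> lim (u @ \oo) by exact: cauchy_cvg.
exists (lim (u @ \oo)) => e e0.
have e0' : (0 : R[i]) < e%:C by rewrite ltcR.
have [N _ uN] := up _ e0'.
exists N => n /uN /=.
by rewrite -ball_normE /= normC_rnorm ltcR rnormBC.
Qed.

End Limits.

(** * Riesz representation *)

Lemma invS_small (R : realType) (e : R) : 0 < e ->
  exists N, forall n, (N <= n)%N -> n.+1%:R^-1 < e.
Proof.
move=> e0; have [N _ hN] := near_infty_natSinv_lt (PosNum e0).
by exists N => n Nn; apply: hN.
Qed.

Lemma sqnormZC (R : realType) (H : hilbertType R) (a : R[i]) (x : H) :
  sqnorm (a *: x) = (complex.Re a ^+ 2 + complex.Im a ^+ 2) * sqnorm x.
Proof.
rewrite -!rdotxx /rdot dotpZl dotpZr dotpxx /=.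
by case: a => a b /=; ring.
Qed.

Section RieszRelation.
Variables (R : realType) (H : hilbertType R) (N : H -> R[i] -> Prop) (C : R).
Hypothesis N0 : N 0 0.
Hypothesis NL : forall a x c y d, N x c -> N y d -> N (a *: x + y) (a * c + d).
Hypothesis NC : forall x c, N x c -> 2 * complex.Re c <= C + sqnorm x.

(** When [c = <x, p>] this is [|p|^2 - |x - p|^2], so the representing vector is sought as the limit
    of a maximising sequence. *)
Let val (x : H) (c : R[i]) : R := 2 * complex.Re c - sqnorm x.
Let vals := [set v : R | exists x c, N x c /\ v = val x c].

Let has_sup_vals : has_sup vals.
Proof.
split; first by exists (val 0 0), 0, 0.
exists C => _ [x [c [Nxc ->]]]; rewrite /val.
by have := NC Nxc; lra.
Qed.

Let val_le x c : N x c -> val x c <= sup vals.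
Proof.
move=> Nxc; apply: sup_upper_bound => //.
by exists x, c.
Qed.

(** Parallelogram law: the value at the midpoint of x and y exceeds the mean of their two values by
    [|x - y|^2 / 4], and it is at most the supremum. *)
Let near_sup_close x c y d (e : R) : N x c -> N y d ->
  sup vals - e <= val x c -> sup vals - e <= val y d ->
  sqnorm (x - y) <= 4 * e.
Proof.
move=> Nx Ny; have Nm := NL (2^-1 : R)%:C (NL 1 Nx Ny) N0.
have := val_le Nm; rewrite /val !addr0 scale1r mul1r sqnormZ !sqnormD sqnormN.
rewrite rdotNr; case: c d {Nx Ny Nm} => [a b] [a' b'] /=.
by lra.
Qed.

(** [N] is a linear relation: that x determines c is part of the conclusion, so a functional may be
    given through a map that is not injective. [NC] is boundedness in quadratic form. The last
    clause places p in the closure of the domain, so closed conditions on the domain pass to p. *)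
Lemma riesz_relation : exists p : H,
  [/\ sqnorm p <= C, forall x c, N x c -> c = dotp x p &
      forall e : R, 0 < e -> exists x c, N x c /\ rnorm (p - x) < e].
Proof.
have /choice[u uP] (k : nat) : exists xc : H * R[i],
    N xc.1 xc.2 /\ sup vals - k.+1%:R^-1 <= val xc.1 xc.2.
  have k0 : 0 < k.+1%:R^-1 :> R by rewrite invr_gt0 ltr0n.
  have [_ [x [c [Nxc ->]]] /ltW v] := sup_adherent k0 has_sup_vals.
  by exists (x, c).
have [p up] : exists p, tends (fun k => (u k).1) p.
  apply: hilbert_complete => e e0.
  have e20 : 0 < (e / 2) ^+ 2 by rewrite exprn_gt0 // divr_gt0.
  have [M hM] := invS_small e20.
  exists M => n m Mn Mm; rewrite -ltr_sqr ?nnegrE ?rnorm_ge0 ?(ltW e0) //.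
  have [Nn vn] := uP n; have [Nm vm] := uP m.
  have hn : sup vals - M.+1%:R^-1 <= val (u n).1 (u n).2.
    by apply: le_trans vn; rewrite lerB // lef_pV2 ?posrE // ler_nat.
  have hm : sup vals - M.+1%:R^-1 <= val (u m).1 (u m).2.
    by apply: le_trans vm; rewrite lerB // lef_pV2 ?posrE // ler_nat.
  have := near_sup_close Nn Nm hn hm; have := hM _ (leqnn M).
  by rewrite sqnormE expr_div_n; move: (M.+1%:R^-1 : R) => q; lra.
have adh e : 0 < e -> exists x c, N x c /\ rnorm (p - x) < e.
  move=> e0; have [M hM] := up _ e0; exists (u M).1, (u M).2.
  by rewrite rnormBC; split; [case: (uP M)|exact: hM].
(* Variation of the maximiser: [u k] is maximal up to [1/(k+1)], hence no worse than [u k + x] up to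
   that error; then k tends to infinity. *)
have ineq x c : N x c -> 2 * complex.Re c - 2 * rdot x p <= sqnorm x.
  move=> Nxc; apply/ler_addgt0Pr => e e0.
  have e4 : 0 < e / (4 * (rnorm x + 1)).
    by rewrite divr_gt0 // mulr_gt0 // ltr_wpDl // rnorm_ge0.
  have [M1 h1] := up _ e4.
  have [M2 h2] := invS_small (divr_gt0 e0 (ltr0Sn R 1)).
  set k := maxn M1 M2.
  have {h1} h1 := h1 k (leq_maxl _ _); have {h2} h2 := h2 k (leq_maxr _ _).
  have [Nk vk] := uP k.
  have := val_le (NL 1 Nk Nxc); move: vk h2.
  rewrite /val scale1r mul1r sqnormD.
  have : rdot x ((u k).1 - p) <= e / 4.
    apply: (le_trans (rdot_le_rnorm _ _)).
    have x1 : 0 < rnorm x + 1 by rewrite ltr_wpDl // rnorm_ge0.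
    have : rnorm ((u k).1 - p) * (4 * (rnorm x + 1)) < e.
      by rewrite -ltr_pdivlMr // mulr_gt0.
    by have := rnorm_ge0 ((u k).1 - p); have := rnorm_ge0 x; nra.
  rewrite rdotDr rdotNr (rdotC x) (rdotC _ x) raddfD /=.
  by move: (k.+1%:R^-1 : R) => q; rewrite (rdotC x p) (rdotC x (u k).1); lra.
(* Inserting the multiple [t d^*] of x in [ineq] gives [2 t |d|^2 <= t^2 |d|^2 |x|^2]; the choice of
   t makes [t |x|^2 < 1], so d vanishes. *)
have rep x c : N x c -> c = dotp x p.
  move=> Nxc; apply/subr0_eq; set d := c - _.
  pose t : R := (sqnorm x + 1)^-1.
  have t0 : 0 < t by rewrite invr_gt0 ltr_wpDl // sqnorm_ge0.
  have tE : t * (sqnorm x + 1) = 1.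
    by rewrite mulVf // gt_eqF // ltr_wpDl // sqnorm_ge0.
  have := ineq _ _ (NL (t%:C * d^*) Nxc N0).
  rewrite !addr0 sqnormZC /rdot dotpZl.
  rewrite -mulrBr -raddfB -mulrBr -/d.
  case: d => a b /=; have := sqnorm_ge0 x => x0 h.
  have : (a ^+ 2 + b ^+ 2) * t <= 0 by nra.
  rewrite pmulr_lle0 // => ab.
  have a0 : a = 0 by nra.
  have b0 : b = 0 by nra.
  by rewrite a0 b0.
exists p; split => //.
(* For x in the domain, [NC] now reads [|p|^2 - |p - x|^2 <= C], and x can be taken close to p. *)
apply/ler_addgt0Pr => e e0.
have e1 : 0 < Num.sqrt e by rewrite sqrtr_gt0.
have [x [c [Nxc px]]] := adh _ e1.
have := NC Nxc; rewrite (rep _ _ Nxc) -/(rdot x p).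
have : sqnorm (p - x) <= e.
  rewrite sqnormE -(sqr_sqrtr (ltW e0)) ler_sqr ?nnegrE ?sqrtr_ge0 //.
    exact: ltW.
  exact: rnorm_ge0.
by rewrite sqnormB (rdotC p); lra.
Qed.

End RieszRelation.

(** * Bounded operators *)

Section LinearMaps.
Variables (R : realType) (V W : lmodType R[i]) (T : V -> W).
Hypothesis linT : linear T.

Let T' : {linear V -> W} :=
  HB.pack T (GRing.isLinear.Build R[i] V W *:%R T linT).

Lemma lin0 : T 0 = 0. Proof. exact: (linear0 T'). Qed.
Lemma linD x y : T (x + y) = T x + T y. Proof. exact: (linearD T'). Qed.
Lemma linB x y : T (x - y) = T x - T y. Proof. exact: (linearB T'). Qed.
Lemma linZ a x : T (a *: x) = a *: T x. Proof. exact: (linearZ_LR T'). Qed.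
Lemma lin_sum I (r : seq I) (P : pred I) (E : I -> V) :
  T (\sum_(i <- r | P i) E i) = \sum_(i <- r | P i) T (E i).
Proof. exact: (linear_sum T'). Qed.

End LinearMaps.

Section BoundedMaps.
Variables (R : realType) (H1 H2 H3 : hilbertType R).
Implicit Types (T : H1 -> H2).

Lemma bounded_linearP T : bounded_linear T <-> linear T /\
  exists2 c : R, 0 <= c & forall x, rnorm (T x) <= c * rnorm x.
Proof.
split=> [[linT [[a b] TM]]|[linT [c c0 Tc]]]; split=> //; last first.
  by exists c%:C => x; rewrite !normC_rnorm -rmorphM lecR.
exists `|a| => // x.
have := TM x; rewrite !normC_rnorm lecE => /andP[_] /=.
rewrite mulr0 subr0 => /le_trans; apply.
by rewrite ler_wpM2r ?rnorm_ge0 // ler_norm.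
Qed.

End BoundedMaps.

Section BoundedMapOperations.
Variables (R : realType) (H1 H2 H3 : hilbertType R).
Implicit Types (T : H1 -> H2).

Lemma bounded_linear0 : bounded_linear (0 : H1 -> H2).
Proof.
apply/bounded_linearP; split=> [a x y|]; first by rewrite /= scaler0 addr0.
by exists 0 => // x; rewrite mul0r rnorm0.
Qed.

Lemma bounded_linearD T (T' : H1 -> H2) :
  bounded_linear T -> bounded_linear T' -> bounded_linear (T + T').
Proof.
move=> /bounded_linearP[lT [c c0 Tc]] /bounded_linearP[lT' [d d0 Td]].
apply/bounded_linearP; split=> [a x y|].
  by rewrite !fctE lT lT' scalerDr addrACA.
exists (c + d); first exact: addr_ge0.
move=> x; rewrite mulrDl; apply: le_trans (rnormD _ _) _.
exact: lerD.
Qed.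

Lemma bounded_linearN T : bounded_linear T -> bounded_linear (- T).
Proof.
move=> /bounded_linearP[lT [c c0 Tc]].
apply/bounded_linearP; split=> [a x y|]; first by rewrite !fctE lT opprD scalerN.
by exists c => // x; rewrite rnormN.
Qed.

Lemma bounded_linearZ (a : R[i]) T : bounded_linear T -> bounded_linear (a *: T).
Proof.
move=> /bounded_linearP[lT [c c0 Tc]].
pose k : R := Num.sqrt (complex.Re a ^+ 2 + complex.Im a ^+ 2).
apply/bounded_linearP; split=> [b x y|].
  by rewrite !scalrfctE /= lT scalerDr !scalerA mulrC.
exists (k * c) => [|x]; first by rewrite mulr_ge0 ?sqrtr_ge0.
rewrite -mulrA; apply: (@le_trans _ _ (k * rnorm (T x))).
  rewrite ler_rnorm ?sqrtr_ge0 // scalrfctE sqnormZC sqr_sqrtr //.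
  by rewrite addr_ge0 ?sqr_ge0.
by rewrite ler_wpM2l ?sqrtr_ge0.
Qed.

Lemma bounded_linear_sum I (r : seq I) (P : pred I) (E : I -> H1 -> H2) :
  (forall i, bounded_linear (E i)) ->
  bounded_linear (\sum_(i <- r | P i) E i).
Proof.
move=> hE; elim/big_ind: _ => // [|T T' hT hT'].
  exact: bounded_linear0.
exact: bounded_linearD.
Qed.

Lemma bounded_linear_comp T (T' : H2 -> H3) :
  bounded_linear T' -> bounded_linear T -> bounded_linear (T' \o T).
Proof.
move=> /bounded_linearP[lT' [d d0 Td]] /bounded_linearP[lT [c c0 Tc]].
apply/bounded_linearP; split=> [a x y|]; first by rewrite /= lT lT'.
exists (d * c); first exact: mulr_ge0.
move=> x; apply: le_trans (Td _) _.
by rewrite -mulrA ler_wpM2l.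
Qed.

(** Existence of the adjoint: Riesz representation of [x |-> <T x, y>], with [C = (c |y|)^2] because
    [2 c |x| |y| <= (c |y|)^2 + |x|^2]. *)
Lemma dotp_adj T x y : bounded_linear T -> dotp (T x) y = dotp x (adj T y).
Proof.
move=> /bounded_linearP[lT [c c0 Tc]]; move: x.
suff [p hp] : exists p, forall x, dotp (T x) y = dotp x p.
  have := ex_intro [set x' | forall x, dotp (T x) y = dotp x x'] p hp.
  exact: xgetPex.
pose N x d := d = dotp (T x) y.
have N0 : N 0 0 by rewrite /N (lin0 lT) dotp0l.
have NL a x d x' d' : N x d -> N x' d' -> N (a *: x + x') (a * d + d').
  by rewrite /N => -> ->; rewrite lT dotpDl dotpZl.
have NC x d : N x d -> 2 * complex.Re d <= (c * rnorm y) ^+ 2 + sqnorm x.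
  move=> ->; have := rdot_le_rnorm (T x) y; rewrite /rdot sqnormE.
  have := Tc x; have := rnorm_ge0 x; have := rnorm_ge0 y.
  move: (rnorm (T x)) (rnorm x) (rnorm y) (complex.Re _) => a b q e q0 b0 ab.
  have : a * q <= c * b * q by rewrite ler_wpM2r.
  have := sqr_ge0 (c * q - b); nra.
have [p [_ hp _]] := riesz_relation N0 NL NC.
by exists p => x; apply: hp.
Qed.

Lemma adj_unique T (T' : H2 -> H1) :
  (forall x y, dotp (T x) y = dotp x (T' y)) -> adj T = T'.
Proof.
move=> TT'; apply/funext => y; apply: dotp_ext => x; rewrite -TT'.
have TT'y x' : dotp (T x') y = dotp x' (T' y) by [].
have ex := ex_intro [set x' | forall x, dotp (T x) y = dotp x x'] _ TT'y.
by rewrite (xgetPex 0 ex).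
Qed.

Lemma linear_adj T : bounded_linear T -> linear (adj T).
Proof.
move=> bT a x y; apply: dotp_ext => z.
by rewrite dotpDr dotpZr -!dotp_adj // dotpDr dotpZr.
Qed.

(** Divide [|T^* y|^2 = <T T^* y, y> <= c |T^* y| |y|] by [|T^* y|]. *)
Lemma rnorm_adj T (c : R) : bounded_linear T -> 0 <= c ->
  (forall x, rnorm (T x) <= c * rnorm x) ->
  forall y, rnorm (adj T y) <= c * rnorm y.
Proof.
move=> bT c0 Tc y.
have [y0|y0] := eqVneq (rnorm (adj T y)) 0.
  by rewrite y0 mulr_ge0 // rnorm_ge0.
have y_gt0 : 0 < rnorm (adj T y) by rewrite lt_neqAle eq_sym y0 rnorm_ge0.
rewrite -(ler_pM2r y_gt0) -expr2 -sqnormE -rdotxx /rdot -dotp_adj //.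
apply: le_trans (rdot_le_rnorm _ _) _.
by rewrite -mulrA (mulrC (rnorm y)) mulrA ler_wpM2r // rnorm_ge0.
Qed.

Lemma bounded_linear_adj T : bounded_linear T -> bounded_linear (adj T).
Proof.
move=> bT; have /bounded_linearP[_ [c c0 Tc]] := bT.
apply/bounded_linearP; split; first exact: linear_adj.
by exists c => //; apply: rnorm_adj.
Qed.

Lemma orthc_sub T x y :
  orthc (opker T) x -> orthc (opker T) y -> orthc (opker T) (x - y).
Proof. by move=> hx hy z Tz; rewrite dotpBl hx // hy // subrr. Qed.

(** The Riesz vector p of [<., g>] restricted to [Ker T] is the projection of g onto the kernel, so
    [g - p] is the projection onto its complement. *)
Lemma orthprojP T g : bounded_linear T ->
  let q := orthproj (orthc (opker T)) g in
  T (g - q) = 0 /\ orthc (opker T) q.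
Proof.
move=> bT; have /bounded_linearP[lT [c c0 Tc]] := bT.
pose N x d := T x = 0 /\ d = dotp x g.
have N0 : N 0 0 by split; rewrite ?(lin0 lT) ?dotp0l.
have NL a x d x' d' : N x d -> N x' d' -> N (a *: x + x') (a * d + d').
  move=> [Tx ->] [Tx' ->]; split; last by rewrite dotpDl dotpZl.
  by rewrite lT Tx Tx' scaler0 addr0.
have NC x d : N x d -> 2 * complex.Re d <= sqnorm g + sqnorm x.
  move=> [_ ->]; rewrite -/(rdot x g); have := sqnorm_ge0 (x - g).
  by rewrite sqnormB; lra.
have [p [_ hp clp]] := riesz_relation N0 NL NC.
(* So far p is only adherent to the kernel; boundedness of T puts it inside. *)
have Tp : T p = 0.
  apply: rnorm_eq0; apply/le_anti; rewrite rnorm_ge0 andbT.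
  apply/ler_addgt0Pr => e e0; rewrite add0r.
  have [|x [d [[Tx _] px]]] := clp (e / (c + 1)).
    by rewrite divr_gt0 // ltr_wpDl.
  have := Tc (p - x); rewrite (linB lT) Tx subr0 => /le_trans; apply.
  rewrite ltr_pdivlMr ?ltr_wpDl // in px.
  by have := rnorm_ge0 (p - x); nra.
have orth : orthc (opker T) (g - p).
  move=> x Tx; rewrite dotpC dotpBr -(hp x (dotp x g)) //.
  by rewrite subrr rmorph0.
have orth2 : orthc (orthc (opker T)) p.
  by move=> x hx; rewrite dotpC hx // rmorph0.
have ex : [set q | orthc (opker T) q /\ orthc (orthc (opker T)) (g - q)] (g - p).
  by split=> //; rewrite opprB addrC subrK.
have [hq hq2] := xgetPex 0 (ex_intro _ _ ex).
rewrite /= /orthproj; set q := xget _ _ in hq hq2 *.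
split=> //; suff -> : g - q = p by [].
apply/subr0_eq/sqnorm_eq0; rewrite -rdotxx /rdot.
have -> : dotp (g - q - p) (g - q - p) =
    dotp (g - q) (g - q - p) - dotp p (g - q - p).
  by rewrite dotpBl.
have h : orthc (opker T) (g - q - p) by rewrite addrAC; apply: orthc_sub.
by rewrite hq2 // orth2 // subrr.
Qed.

Lemma map_orthproj T g : bounded_linear T ->
  T (orthproj (orthc (opker T)) g) = T g.
Proof.
move=> bT; have [lT _] := bT; have [+ _] := orthprojP g bT.
by rewrite (linB lT) => /subr0_eq.
Qed.

Lemma orthproj_id T g : bounded_linear T -> orthc (opker T) g ->
  orthproj (orthc (opker T)) g = g.
Proof.
move=> bT hg; have [Tq hq] := orthprojP g bT.
apply/esym/subr0_eq/sqnorm_eq0; rewrite -rdotxx /rdot.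
by rewrite (orthc_sub hg hq).
Qed.

Lemma dotp_orthprojr T g x : bounded_linear T -> orthc (opker T) x ->
  dotp x (orthproj (orthc (opker T)) g) = dotp x g.
Proof.
move=> bT hx; have [Tq _] := orthprojP g bT.
by apply/esym/subr0_eq; rewrite -dotpBr hx.
Qed.

Lemma sqnorm_orthproj T g : bounded_linear T ->
  sqnorm (orthproj (orthc (opker T)) g) <= sqnorm g.
Proof.
move=> bT; have [Tq hq] := orthprojP g bT.
set q := orthproj _ _ in Tq hq *.
rewrite -[in leRHS](subrK q g) sqnormD /rdot dotpC hq // rmorph0.
by have := sqnorm_ge0 (g - q); rewrite /=; lra.
Qed.

End BoundedMapOperations.

Lemma conjC_real (R : realType) (t : R) : Num.conj (t%:C : R[i]) = t%:C.
Proof. exact: conjc_real. Qed.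

(** * Square roots of positive operators *)

Section TendsTheory.
Variables (R : realType) (H : hilbertType R).
Implicit Types (u v : nat -> H) (p q x y : H).

Lemma tends_const p : tends (fun=> p) p.
Proof. by move=> e e0; exists 0%N => n _; rewrite subrr rnorm0. Qed.

Lemma tends_shift u p : tends u p -> tends (fun n => u n.+1) p.
Proof.
by move=> up e /up[N hN]; exists N => n Nn; apply: hN; apply: leqW.
Qed.

Lemma tends_bound (c : R) u p v q : 0 <= c ->
  (forall n, rnorm (v n - q) <= c * rnorm (u n - p)) -> tends u p -> tends v q.
Proof.
move=> c0 vu up e e0; have [|N hN] := up (e / (c + 1)).
  by rewrite divr_gt0 // ltr_wpDl.
exists N => n Nn; apply: le_lt_trans (vu n) _.
have := hN n Nn; rewrite ltr_pdivlMr ?ltr_wpDl //.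
by have := rnorm_ge0 (u n - p); nra.
Qed.

Lemma tendsD u v p q : tends u p -> tends v q -> tends (fun n => u n + v n) (p + q).
Proof.
move=> up vq e e0; have e20 : 0 < e / 2 by rewrite divr_gt0.
have [N hN] := up _ e20; have [M hM] := vq _ e20.
exists (maxn N M) => n; rewrite geq_max => /andP[/hN Nn /hM Mn].
by rewrite opprD addrACA; apply: le_lt_trans (rnormD _ _) _; lra.
Qed.

Lemma tends_unique u p q : tends u p -> tends u q -> p = q.
Proof.
move=> up uq; apply/subr0_eq/rnorm_eq0/le_anti; rewrite rnorm_ge0 andbT.
apply/ler_addgt0Pr => e e0; rewrite add0r.
have e20 : 0 < e / 2 by rewrite divr_gt0.
have [N hN] := up _ e20; have [M hM] := uq _ e20.
have h1 := hN _ (leq_maxl N M); have h2 := hM _ (leq_maxr N M).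
rewrite -(subrK (u (maxn N M)) p) -addrA; apply: le_trans (rnormD _ _) _.
by rewrite rnormBC; lra.
Qed.

Lemma tends_rnorm_le u p (c : R) : (forall n, rnorm (u n) <= c) -> tends u p ->
  rnorm p <= c.
Proof.
move=> uc up; apply/ler_addgt0Pr => e e0; have [N hN] := up _ e0.
have h := hN _ (leqnn N); rewrite -(subrK (u N) p).
apply: le_trans (rnormD _ _) _; rewrite rnormBC.
by have := uc N; lra.
Qed.

Lemma tends_rdot u p y (e : R) : tends u p -> 0 < e ->
  exists N, forall n, (N <= n)%N -> `|rdot (u n) y - rdot p y| < e.
Proof.
move=> up e0; have y1 : 0 < rnorm y + 1 by rewrite ltr_wpDl // rnorm_ge0.
have [|N hN] := up (e / (rnorm y + 1)); first by rewrite divr_gt0.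
exists N => n /hN; rewrite ltr_pdivlMr // -rdotNl -rdotDl.
have := rdot_le_rnorm (u n - p) y; have := rdot_le_rnorm (- (u n - p)) y.
rewrite rnormN rdotNl; have := rnorm_ge0 (u n - p).
rewrite ltr_norml; move: (rdot _ _) (rnorm _) => a b.
by move=> b0 h1 h2 h3; apply/andP; split; nra.
Qed.

Lemma tendsZ (a : R[i]) u p : tends u p -> tends (fun n => a *: u n) (a *: p).
Proof.
apply: (@tends_bound (Num.sqrt (complex.Re a ^+ 2 + complex.Im a ^+ 2))).
  exact: sqrtr_ge0.
move=> n; rewrite ler_rnorm ?sqrtr_ge0 // -scalerBr sqnormZC sqr_sqrtr //.
by rewrite addr_ge0 ?sqr_ge0.
Qed.

Lemma tends_dotp_eq u v p q x y : tends u p -> tends v q ->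
  (forall n, dotp (u n) y = dotp x (v n)) -> dotp p y = dotp x q.
Proof.
suff re u' v' p' q' x' y' : tends u' p' -> tends v' q' ->
    (forall n, rdot (u' n) y' = rdot x' (v' n)) -> rdot p' y' = rdot x' q'.
  move=> up vq uv; apply: eq_dotp; first by apply: re up vq _ => n; rewrite /rdot uv.
  apply: (re _ _ _ _ _ _ up (tendsZ 'i vq)) => n.
  by rewrite -!Im_dotp uv.
move=> up vq uv; apply/subr0_eq/normr0_eq0/le_anti; rewrite normr_ge0 andbT.
apply/ler_addgt0Pr => e e0; have e20 : 0 < e / 2 by rewrite divr_gt0.
have [N hN] := tends_rdot y' up e20; have [M hM] := tends_rdot x' vq e20.
have := hN _ (leq_maxl N M); have := hM _ (leq_maxr N M).
rewrite uv !(rdotC _ x') !ltr_norml ler_norml add0r => /andP[h1 h2] /andP[h3 h4].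
by apply/andP; split; lra.
Qed.

End TendsTheory.

Lemma symmetric_dotp_ge0 (R : realType) (H : hilbertType R) (x y : H) :
  dotp x y = dotp y x -> 0 <= rdot x y -> 0 <= dotp x y.
Proof.
rewrite (dotpC y) lecE /rdot; case: (dotp x y) => a b /= [] h ->.
by rewrite andbT; apply/eqP; lra.
Qed.

(** Polarisation: the sesquilinear form q measuring asymmetry vanishes on the diagonal, and the
    vectors [x + y] and [x + 'i *: y] then make it vanish everywhere. *)
Lemma positive_symmetric (R : realType) (H : hilbertType R) (D : H -> H) :
  linear D -> (forall x, 0 <= dotp (D x) x) ->
  forall x y, dotp (D x) y = dotp x (D y).
Proof.
move=> lD pD x y; pose q x y := dotp (D x) y - dotp x (D y).
have q0 z : q z z = 0.
  rewrite /q (dotpC z); have := ger0_Im (pD z); case: (dotp _ _) => a b /= ->.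
  by apply/eqP; rewrite eq_complex /=; apply/andP; split; apply/eqP; ring.
have qD (a : R[i]) u v : q (u + a *: v) (u + a *: v) = a^* * q u v + a * q v u.
  rewrite /q (linD lD) (linZ lD) !(dotpDl, dotpDr, dotpZl, dotpZr).
  move: (q0 u) (q0 v) => /subr0_eq -> /subr0_eq ->; ring.
apply/subr0_eq; rewrite -/(q x y).
have := q0 (x + 1 *: y); have := q0 (x + 'i *: y); rewrite !qD.
case: (q x y) (q y x) => [a b] [c d] /= [] h1 h2 [] h3 h4.
by apply/eqP; rewrite eq_complex /=; apply/andP; split; apply/eqP; lra.
Qed.

Section SquareRoot.
Variables (R : realType) (H : hilbertType R) (B : H -> H).
Hypothesis lB : linear B.
Hypothesis B1 : forall x, rnorm (B x) <= rnorm x.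
Hypothesis symB : forall x y, dotp (B x) y = dotp x (B y).

Let half : R[i] := (2^-1 : R)%:C.

(* [1 - sqrt (1 - B)] is the limit of the iteration X |-> (B + X^2) / 2, and
   the same iteration with B = 1 dominates it in norm. *)
Fixpoint sqrt_iter (n : nat) (x : H) : H :=
  if n is n'.+1 then half *: (B x + sqrt_iter n' (sqrt_iter n' x)) else 0.

Fixpoint sqrt_rate (n : nat) : R :=
  if n is n'.+1 then (1 + sqrt_rate n' ^+ 2) / 2 else 0.

Local Notation X := sqrt_iter.
Local Notation r := sqrt_rate.

Lemma sqrt_rate_ge0 n : 0 <= r n.
Proof. by case: n => //= n; rewrite divr_ge0 // addr_ge0 // sqr_ge0. Qed.

Lemma sqrt_rate_le1 n : r n <= 1.
Proof. by elim: n => [|n IH] /=; [|have := sqrt_rate_ge0 n; nra]. Qed.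

Lemma sqrt_rateS n : r n <= r n.+1.
Proof. by rewrite /=; have := sqr_ge0 (r n - 1); lra. Qed.

Lemma sqrt_rate_mono n m : (n <= m)%N -> r n <= r m.
Proof.
move=> /subnKC <-; elim: (m - n)%N => [|k IH]; first by rewrite addn0.
by rewrite addnS; apply: le_trans IH (sqrt_rateS _).
Qed.

(** The rates increase and stay below 1, which gives convergence without computing the limit. *)
Lemma sqrt_rate_cauchy (e : R) : 0 < e ->
  exists N, forall n, (N <= n)%N -> r n - r N < e.
Proof.
move=> e0; have hs : has_sup (range r).
  split; first by exists (r 0%N), 0%N.
  by exists 1 => _ [n _ <-]; apply: sqrt_rate_le1.
have [_ [N _ <-] hN] := sup_adherent e0 hs; exists N => n _.
have : r n <= sup (range r) by apply: sup_upper_bound => //; exists n.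
by lra.
Qed.

Lemma linear_sqrt_iter n : linear (X n).
Proof.
elim: n => [|n IH] a x y /=; first by rewrite scaler0 addr0.
rewrite lB !IH scalerA mulrC -scalerA -scalerDr; congr (_ *: _).
by rewrite addrACA scalerDr.
Qed.

Lemma sqrt_iter_comm n (C : H -> H) : linear C ->
  (forall x, C (B x) = B (C x)) -> forall x, C (X n x) = X n (C x).
Proof.
move=> linC CB; elim: n => [|n IH] x /=; first exact: lin0.
by rewrite (linZ linC) (linD linC) CB !IH.
Qed.

Lemma sqrt_iter_comm_iter n m x : X n (X m x) = X m (X n x).
Proof.
apply: sqrt_iter_comm; first exact: linear_sqrt_iter.
by move=> y; rewrite (sqrt_iter_comm n lB).
Qed.

Lemma rnorm_half (x : H) : rnorm (half *: x) = rnorm x / 2.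
Proof. by rewrite rnormZ ger0_norm ?invr_ge0 // mulrC. Qed.

Lemma rnorm_sqrt_iter n x : rnorm (X n x) <= r n * rnorm x.
Proof.
elim: n x => [|n IH] x; first by rewrite /= rnorm0 mul0r.
rewrite [X _ _]/= rnorm_half.
have := rnormD (B x) (X n (X n x)); have := B1 x.
have : rnorm (X n (X n x)) <= r n * (r n * rnorm x).
  by apply: le_trans (IH _) _; rewrite ler_wpM2l // sqrt_rate_ge0.
by rewrite /=; nra.
Qed.

(** Since the iterates commute, [X_(n+2) - X_(n+1)] is half the product of [X_(n+1) - X_n] and
    [X_(n+1) + X_n]. The rates obey the same identity, so the bound propagates. *)
Lemma rnorm_sqrt_iterS n x :
  rnorm (X n.+1 x - X n x) <= (r n.+1 - r n) * rnorm x.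
Proof.
elim: n x => [|n IH] x.
  rewrite /= subr0 addr0 rnorm_half expr0n addr0 subr0.
  by have := B1 x; lra.
have -> : X n.+2 x - X n.+1 x =
    half *: (X n.+1 (X n.+1 x + X n x) - X n (X n.+1 x + X n x)).
  rewrite [X n.+2 x]/= [in X in _ - X]/= -/(X n.+1 _) -scalerBr; congr (_ *: _).
  rewrite !(linD (linear_sqrt_iter _)) (sqrt_iter_comm_iter n.+1 n x).
  by rewrite opprD addrACA subrr add0r opprD addrA addrK.
rewrite rnorm_half.
have : rnorm (X n.+1 x + X n x) <= (r n.+1 + r n) * rnorm x.
  by rewrite mulrDl; apply: le_trans (rnormD _ _) _; rewrite lerD ?rnorm_sqrt_iter.
have := IH (X n.+1 x + X n x); have := sqrt_rateS n.
have -> : r n.+2 - r n.+1 = (r n.+1 - r n) * (r n.+1 + r n) / 2 by rewrite /=; field.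
move: (r n.+1) (r n) => a b ab.
move: (rnorm x) (rnorm (X n.+1 x + _)) (rnorm _) => p q s h1 h2.
have : (a - b) * q <= (a - b) * ((a + b) * p) by rewrite ler_wpM2l // subr_ge0.
by lra.
Qed.

Lemma rnorm_sqrt_iterB n m x : (n <= m)%N ->
  rnorm (X m x - X n x) <= (r m - r n) * rnorm x.
Proof.
move=> /subnKC <-; elim: (m - n)%N => [|k IH].
  by rewrite addn0 !subrr mul0r rnorm0.
rewrite addnS -(subrK (X (n + k) x) (X _.+1 x)) -addrA.
apply: le_trans (rnormD _ _) _.
by have := rnorm_sqrt_iterS (n + k) x; lra.
Qed.

Lemma sqrt_iter_cvg x : exists p, tends (fun n => X n x) p.
Proof.
apply: hilbert_complete => e e0.
have x1 : 0 < rnorm x + 1 by rewrite ltr_wpDl // rnorm_ge0.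
have [|N hN] := @sqrt_rate_cauchy (e / (2 * (rnorm x + 1))).
  by rewrite divr_gt0 // mulr_gt0.
have close n : (N <= n)%N -> rnorm (X n x - X N x) < e / 2.
  move=> Nn; apply: le_lt_trans (rnorm_sqrt_iterB x Nn) _.
  have := hN n Nn; rewrite ltr_pdivlMr ?mulr_gt0 // ltr_pdivlMr //.
  by have := sqrt_rate_mono Nn; have := rnorm_ge0 x; nra.
exists N => n m /close hn /close hm.
rewrite -(subrK (X N x) (X n x)) -addrA.
apply: le_lt_trans (rnormD _ _) _; rewrite (rnormBC (X N x)).
by lra.
Qed.

(** The limit L of the iteration satisfies [2 L = B + L^2], so [D = 1 - L] squares to [1 - B]; it is
    positive because L is a contraction. The commutation clause serves to carry the representation
    of the algebra over to the range of D. *)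
Lemma exists_psqrt : exists D : H -> H,
  [/\ bounded_linear D, forall x, 0 <= dotp (D x) x, forall x, D (D x) = x - B x &
      forall C, bounded_linear C -> (forall x, C (B x) = B (C x)) ->
        forall x, C (D x) = D (C x)].
Proof.
have /choice[L XL] := sqrt_iter_cvg.
have linL : linear L.
  move=> a x y; apply: (tends_unique (XL _)).
  rewrite (_ : (fun n => _) = (fun n => a *: X n x + X n y)).
    exact: (tendsD (tendsZ a (XL x)) (XL y)).
  by apply/funext => n; apply: linear_sqrt_iter.
have L1 x : rnorm (L x) <= rnorm x.
  apply: tends_rnorm_le (XL x) => n.
  apply: le_trans (rnorm_sqrt_iter n x) _.
  by rewrite ler_piMl ?rnorm_ge0 // sqrt_rate_le1.
have symX n x y : dotp (X n x) y = dotp x (X n y).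
  elim: n x y => [|n IH] x y /=; first by rewrite dotp0l dotp0r.
  by rewrite dotpZl dotpZr conjC_real dotpDl dotpDr symB !IH.
have symL x y : dotp (L x) y = dotp x (L y).
  by apply: (tends_dotp_eq (XL x) (XL y)) => n; apply: symX.
have commL C : bounded_linear C -> (forall x, C (B x) = B (C x)) ->
    forall x, C (L x) = L (C x).
  move=> /bounded_linearP[lC [c c0 Cc]] CB x; apply: (tends_unique _ (XL (C x))).
  apply: (tends_bound c0) (XL x) => n.
  by rewrite -(sqrt_iter_comm n lC CB) -(linB lC).
have LL x : L x = half *: (B x + L (L x)).
  apply: (tends_unique (tends_shift (XL x))) => /=.
  apply: tendsZ; apply: tendsD; first exact: tends_const.
  (* In this splitting the first term tends to 0 because [X_n] is a contraction, and the second
     converges as the iteration does at [L x]. *)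
  rewrite (_ : (fun n => _) =
    (fun n => (X n (X n x) - X n (L x)) + X n (L x))); last first.
    by apply/funext => n; rewrite subrK.
  rewrite -[L (L x)]add0r; apply: tendsD (XL (L x)).
  apply: (tends_bound ler01) (XL x) => n; rewrite subr0 mul1r.
  rewrite -(linB (linear_sqrt_iter n)); apply: le_trans (rnorm_sqrt_iter _ _) _.
  by rewrite ler_piMl ?rnorm_ge0 // sqrt_rate_le1.
exists (fun x => x - L x); split.
- apply/bounded_linearP; split=> [a x y|].
    by rewrite linL opprD addrACA scalerBr.
  exists 2 => // x; apply: le_trans (rnormD _ _) _; rewrite rnormN.
  by have := L1 x; lra.
- move=> x; apply: symmetric_dotp_ge0; first by rewrite dotpBl dotpBr symL.
  rewrite rdotDl rdotNl rdotxx sqnormE; have := rdot_le_rnorm (L x) x.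
  by have := L1 x; have := rnorm_ge0 x; nra.
- move=> x; have LL2 : L x + L x = B x + L (L x).
    rewrite {1 2}LL -scalerDl -[RHS]scale1r; congr (_ *: _).
    by rewrite /half -rmorphD -(rmorph1 (real_complex R)); congr _%:C; field.
  have -> : B x = L x + L x - L (L x) by rewrite LL2 addrK.
  rewrite (linB linL) !opprB addrA (addrAC _ (L (L x))).
  by rewrite (addrC (L (L x))) opprD !addrA.
- move=> C bC CB x; have [lC _] := bC.
  by rewrite (linB lC) commL.
Qed.

End SquareRoot.

(** * Orthogonal complements as Hilbert spaces *)

Lemma dotp_adherent0 (R : realType) (H : hilbertType R) (p y : H) :
  (forall e : R, 0 < e -> exists x, dotp x y = 0 /\ rnorm (p - x) < e) ->
  dotp p y = 0.
Proof.
(* The factor a turns the product of p with y into [|a|^2], so an upper bound 0 on its real part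
   forces [a = 0]. *)
move=> py; pose a := dotp p y; pose z := a *: y.
have pz : rdot p z <= 0.
  apply/ler_addgt0Pr => e e0; rewrite add0r.
  have z1 : 0 < rnorm z + 1 by rewrite ltr_wpDl // rnorm_ge0.
  have [|x [xy]] := py (e / (rnorm z + 1)); first by rewrite divr_gt0.
  rewrite ltr_pdivlMr // => xp.
  have -> : rdot p z = rdot (p - x) z.
    by rewrite /rdot dotpBl [dotp x _]dotpZr xy mulr0 subr0.
  apply: le_trans (rdot_le_rnorm _ _) _.
  by have := rnorm_ge0 (p - x); have := rnorm_ge0 z; nra.
move: pz; rewrite /rdot dotpZr /a; case: (dotp p y) => b c /= h.
have b0 : b = 0 by nra.
have c0 : c = 0 by nra.
by rewrite b0 c0.
Qed.

Section OrthocomplementSpace.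
Variables (R : realType) (G : hilbertType R) (N : set G).

Definition orthc_pred : {pred G} := fun x => x \in orthc N.

Lemma orthc_submod_closed : submod_closed orthc_pred.
Proof.
split=> [|a x y]; rewrite !inE; first by move=> z _; rewrite dotp0l.
by move=> hx hy z Nz; rewrite dotpDl dotpZl hx // hy // mulr0 addr0.
Qed.

HB.instance Definition _ :=
  GRing.isSubmodClosed.Build R[i] G orthc_pred orthc_submod_closed.

(** The pull-back norm makes B an isometry from the complement of [Ker B] onto its range. This
    complement, as a Hilbert space of its own, will carry the range space. *)
Record orthsub := OrthSub { orthval : G; _ : orthval \in orthc_pred }.

HB.instance Definition _ := [isSub for orthval].
HB.instance Definition _ := [Choice of orthsub by <:].
HB.instance Definition _ := [SubChoice_isSubLmodule of orthsub by <:].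

Lemma orthvalP (x : orthsub) : orthc N (orthval x).
Proof. by case: x => x /=; rewrite inE. Qed.

Lemma orthval_linear : linear orthval.
Proof. by move=> a x y; rewrite -[LHS]/(val (a *: x + y)) linearP. Qed.

Definition orthsub_norm (x : orthsub) : R[i] := `|orthval x|.

Let normD x y : orthsub_norm (x + y) <= orthsub_norm x + orthsub_norm y.
Proof. by rewrite /orthsub_norm (linD orthval_linear) ler_normD. Qed.

Let normZ (a : R[i]) x : orthsub_norm (a *: x) = `|a| * orthsub_norm x.
Proof. by rewrite /orthsub_norm (linZ orthval_linear) normrZ. Qed.

Let norm0 x : orthsub_norm x = 0 -> x = 0.
Proof.
move=> /normr0_eq0 x0; apply: val_inj.
by rewrite -[LHS]/(orthval x) x0 -[RHS]/(orthval 0) (lin0 orthval_linear).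
Qed.

HB.instance Definition _ := Lmodule_isNormed.Build R[i] orthsub normD normZ norm0.

Lemma orthsub_normE (x : orthsub) : `|x| = `|orthval x|.
Proof. by []. Qed.

(** Limits are taken in G; orthogonality to N is a closed condition, so they stay in the
    complement. *)
Lemma orthsub_complete (F : set_system orthsub) :
  ProperFilter F -> cauchy F -> cvg F.
Proof.
move=> FF cF; pose F' := orthval @ F.
have ballE x y (e : R[i]) : ball x e y = ball (orthval x) e (orthval y).
  by rewrite -!ball_normE /= orthsub_normE (linB orthval_linear).
have cF' : cauchy F'.
  apply/cauchyP => e e0; have [x xF] : exists x, F (ball x e).
    by move/cauchyP: cF => /(_ e e0).
  exists (orthval x); rewrite /F' /= nbhs_filterE.
  rewrite (_ : ball x e = orthval @^-1` ball (orthval x) e) in xF => //.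
  exact/funext.
have /cvg_ballP Fp : F' --> lim F' by exact: cauchy_cvg.
set p := lim F' in Fp.
have hp : orthc N p.
  move=> y Ny; apply: dotp_adherent0 => e e0.
  have e0' : 0 < e%:C by rewrite ltcR.
  have [x] := filter_ex (Fp _ e0').
  rewrite -ball_normE /= normC_rnorm ltcR => px.
  by exists (orthval x); split=> //; apply: orthvalP.
have hp' : p \in orthc_pred by rewrite inE.
apply/cvg_ex; exists (OrthSub hp'); apply/cvg_ballP => e e0.
apply: filterS (Fp e e0) => x px.
by rewrite ballE.
Qed.

HB.instance Definition _ := Uniform_isComplete.Build orthsub orthsub_complete.

Definition orthsub_dotp (x y : orthsub) : R[i] := dotp (orthval x) (orthval y).

Let dotp_bilinear :
  bilinear_for *%R (Num.conj \; *%R) orthsub_dotp.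
Proof.
split=> [y a x x'|x a y y']; rewrite /orthsub_dotp orthval_linear.
  by rewrite dotpDl dotpZl.
by rewrite dotpDr dotpZr.
Qed.

HB.instance Definition _ :=
  bilinear_isBilinear.Build R[i] orthsub orthsub R[i] *%R (Num.conj \; *%R)
    orthsub_dotp dotp_bilinear.

Let dotp_hermitian (x y : orthsub) :
  orthsub_dotp x y = (-1) ^+ false * Num.conj (orthsub_dotp y x).
Proof. by rewrite expr0 mul1r /orthsub_dotp dotpC. Qed.

HB.instance Definition _ :=
  isHermitianSesquilinear.Build R[i] orthsub false Num.conj orthsub_dotp
    dotp_hermitian.

Let dotp_pos (x : orthsub) : x != 0 -> 0 < orthsub_dotp x x.
Proof.
move=> x0; rewrite /orthsub_dotp -sqr_norm_dotp exprn_gt0 // normr_gt0.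
by apply: contra_neq x0 => x0; apply: norm0; rewrite /orthsub_norm x0 normr0.
Qed.

HB.instance Definition _ := isDotProduct.Build R[i] orthsub orthsub_dotp dotp_pos.

Let sqr_norm (x : orthsub) : `|x| ^+ 2 = orthsub_dotp x x.
Proof. by rewrite orthsub_normE sqr_norm_dotp. Qed.

HB.instance Definition _ := isHilbert.Build R orthsub sqr_norm.

End OrthocomplementSpace.

(** * Range spaces and reproducing kernels *)

Section FunctionSpaces.
Variables (R : realType) (s : nc_setting R) (Om : ncsubset (base_set s)).
Local Arguments Om : clear implicits.
Variables (A : cstarType R) (Y : hilbertType R).
Implicit Types (H L : fun_hilbert Om A Y).

Lemma fh_fun_lin H L (a : R[i]) (x y : H) (x' y' : L) :
  fh_fun x = fh_fun x' -> fh_fun y = fh_fun y' ->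
  fh_fun (a *: x + y) = fh_fun (a *: x' + y').
Proof.
move=> xx' yy'; apply: functional_extensionality_dep => n.
apply: functional_extensionality_dep => Z; apply/matrixP => i j.
by rewrite !fh_linear xx' yy'.
Qed.

Lemma fh_fun0 H L : fh_fun (0 : H) = fh_fun (0 : L).
Proof.
apply: functional_extensionality_dep => n.
apply: functional_extensionality_dep => Z; apply/matrixP => i j.
by rewrite !(lin0 (fh_linear _ _ _)).
Qed.

Lemma coldot_ext n (z z' : 'cV[Y]_n) :
  (forall y, coldot z y = coldot z' y) -> z = z'.
Proof.
move=> zz'; apply/matrixP => i j; rewrite (ord1 j).
apply/subr0_eq/sqnorm_eq0; rewrite -rdotxx /rdot.
set x := z i 0 - z' i 0.
have := zz' (\col_k if k == i then x else 0).
have E (w : 'cV[Y]_n) : coldot w (\col_k if k == i then x else 0) = dotp (w i 0) x.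
  rewrite /coldot (bigD1 i) //= big1 ?addr0 => [|k /negPf ki]; rewrite mxE.
    by rewrite eqxx.
  by rewrite ki dotp0r.
by rewrite !E dotpBl => ->; rewrite subrr.
Qed.

(** Columns with a single nonzero entry recover the entries of the matrix, linearity making the
    other terms vanish. *)
Lemma ncmap_ext (f g : ncmap Om A Y) : graded_fun f -> graded_fun g ->
  (forall n (Z : Om n) u, mxapp (f n Z) u = mxapp (g n Z) u) -> f = g.
Proof.
move=> gf gg fg; apply: functional_extensionality_dep => n.
apply: functional_extensionality_dep => Z; apply/matrixP => i j.
apply/funext => a.
have E (h : ncmap Om A Y) : graded_fun h ->
    mxapp (h n Z) (\col_k if k == j then a else 0) i 0 = h n Z i j a.
  move=> gh; rewrite mxE (bigD1 j) //= big1 ?addr0 => [|k /negPf kj].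
    by rewrite mxE eqxx.
  by rewrite mxE kj (lin0 (gh n Z i k).1).
by rewrite -E // fg E.
Qed.

Section Pullback.
Variables (G : hilbertType R) (H : fun_hilbert Om A Y) (B : G -> H).
Hypothesis bB : bounded_linear B.

Let lB := bB.1.

Definition pullback_fun (x : orthsub (opker B)) := fh_fun (B (orthval x)).

Let pullback_fun_linear n (Z : Om n) i j :
  linear (fun x => pullback_fun x Z i j).
Proof. by move=> a x y; rewrite /pullback_fun orthval_linear lB fh_linear. Qed.

Let pullback_fun_inj : injective pullback_fun.
Proof.
move=> x y /fh_inj /eqP; rewrite -subr_eq0 -(linB lB) => /eqP Bxy.
apply/val_inj/subr0_eq/sqnorm_eq0; rewrite -rdotxx /rdot.
by rewrite (orthc_sub (orthvalP x) (orthvalP y)).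
Qed.

Definition pullback_space : fun_hilbert Om A Y :=
  FunHilbert pullback_fun_linear pullback_fun_inj.

Lemma pullback_spaceP : is_pullback B pullback_space.
Proof.
split=> [l|g]; first by exists (orthval l).
have [Bq hq] := orthprojP g bB.
have hq' : orthproj (orthc (opker B)) g \in orthc_pred (opker B) by rewrite inE.
by exists (OrthSub hq'); rewrite /= /pullback_fun /= map_orthproj.
Qed.

Variable L : fun_hilbert Om A Y.
Hypothesis pL : is_pullback B L.

(** The graph of the isometry between L and the complement of [Ker B]. Being a relation, it can be
    added and scaled without choosing representatives. *)
Definition pullback_rel (l : L) (g : G) :=
  fh_fun (B g) = fh_fun l /\ orthc (opker B) g.

Lemma pullback_rel_ex l : exists g, pullback_rel l g.
Proof.
have [g gl] := pL.1 l; exists (orthproj (orthc (opker B)) g).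
by split; [rewrite map_orthproj|case: (orthprojP g bB)].
Qed.

Lemma pullback_rel_orthproj l g : fh_fun (B g) = fh_fun l ->
  pullback_rel l (orthproj (orthc (opker B)) g).
Proof. by split; [rewrite map_orthproj|case: (orthprojP g bB)]. Qed.

Lemma pullback_rel_lin (a : R[i]) l g l' g' :
  pullback_rel l g -> pullback_rel l' g' ->
  pullback_rel (a *: l + l') (a *: g + g').
Proof.
move=> [lg hg] [lg' hg']; split; first by rewrite lB; apply: fh_fun_lin.
by move=> z Bz; rewrite dotpDl dotpZl hg // hg' // mulr0 addr0.
Qed.

Lemma pullback_rel_sqnorm l g : pullback_rel l g -> sqnorm l = sqnorm g.
Proof.
move=> [lg hg]; have [l' [l'g /eq_normC]] := pL.2 g.
rewrite orthproj_id // => <-; congr sqnorm.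
by apply: fh_inj; rewrite l'g.
Qed.

Lemma pullback_rel_dotp l g l' g' :
  pullback_rel l g -> pullback_rel l' g' -> dotp l l' = dotp g g'.
Proof.
have re l1 g1 l2 g2 : pullback_rel l1 g1 -> pullback_rel l2 g2 ->
    rdot l1 l2 = rdot g1 g2.
  move=> h1 h2; have := pullback_rel_sqnorm (pullback_rel_lin 1 h1 h2).
  rewrite !scale1r !sqnormD (pullback_rel_sqnorm h1) (pullback_rel_sqnorm h2).
  by lra.
move=> h h'; apply: eq_dotp; first exact: re.
apply: re => //; rewrite -(addr0 ('i *: l')) -(addr0 ('i *: g')).
apply: pullback_rel_lin => //; split; first by rewrite (lin0 lB); apply: fh_fun0.
by move=> z _; rewrite dotp0l.
Qed.

(** One representative in the complement is enough: projecting the other leaves the product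
    unchanged. *)
Lemma pullback_dotp l g l' g' :
  pullback_rel l g -> fh_fun (B g') = fh_fun l' -> dotp l l' = dotp g g'.
Proof.
move=> h h'; rewrite (pullback_rel_dotp h (pullback_rel_orthproj h')).
by apply: dotp_orthprojr => //; case: h.
Qed.

End Pullback.

End FunctionSpaces.

(** * Uniqueness of the space with a given kernel; kernels and representations of range spaces *)

Section ReproducingKernelSpaces.
Variables (R : realType) (s : nc_setting R) (Om : ncsubset (base_set s)).
Local Arguments Om : clear implicits.
Variables (A : cstarType R) (Y : hilbertType R).
Implicit Types (K : nckmap Om A Y) (H L P : fun_hilbert Om A Y).

Lemma gnc_graded (X X' : normedModType R[i]) (f : ncmap Om X X') :
  gnc_fun f -> graded_fun f.
Proof. by move: Om f; case: s => [T z|V] Om' f []. Qed.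

Lemma adjmxK n m : cancel (@adjmx R A n m) (@adjmx R A m n).
Proof. by move=> P; apply/matrixP => i j; rewrite !mxE starK. Qed.

(** The reproducing clause of [is_rkhs] by itself; together with gradedness it determines the
    space. *)
Definition reproduces K H :=
  forall m (W : Om m) (v : 'rV[A]_m) (y : 'cV[Y]_m),
    exists k : H,
      (forall n (Z : Om n) (u : 'cV[A]_n),
         mxapp (fh_fun k Z) u = mxapp (K n m Z W (mulcmx u v)) y) /\
      (forall f : H,
         coldot (mxapp (fh_fun f W) (adjmx v)) y = dotp f k).

Lemma reproducing_inclusion K H L :
  (forall h : H, graded_fun (fh_fun h)) -> (forall l : L, graded_fun (fh_fun l)) ->
  reproduces K H -> reproduces K L ->
  forall h : H, exists l : L, fh_fun l = fh_fun h /\ sqnorm l <= sqnorm h.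
Proof.
move=> gH gL rH rL h.
(* [pair] is a linear relation containing the pairs of kernel functions, and
   it is isometric: take [f := h'] and [g := l']. *)
pose pair (h' : H) (l' : L) := fh_fun h' = fh_fun l' /\
  forall (f : H) (g : L), fh_fun f = fh_fun g -> dotp f h' = dotp g l'.
have pairL a x x' y y' : pair x x' -> pair y y' ->
    pair (a *: x + y) (a *: x' + y').
  move=> [xx' hx] [yy' hy]; split; first exact: fh_fun_lin.
  by move=> f g fg; rewrite !dotpDr !dotpZr (hx f g fg) (hy f g fg).
(* The functional that h induces on L. Its Riesz vector pairs with the kernel functions of L as h
   does with those of H, hence has the same values as h. *)
pose N (l : L) c := exists2 h' : H, pair h' l & c = dotp h' h.
have N0 : N 0 0.
  exists 0; last by rewrite dotp0l.
  by split=> [|f g _]; [exact: fh_fun0|rewrite !dotp0r].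
have NL a x c y d : N x c -> N y d -> N (a *: x + y) (a * c + d).
  move=> [x' px ->] [y' py ->]; exists (a *: x' + y'); first exact: pairL.
  by rewrite dotpDl dotpZl.
have NC x c : N x c -> 2 * complex.Re c <= sqnorm h + sqnorm x.
  move=> [x' [xx' px] ->]; have := sqnorm_ge0 (x' - h).
  have -> : sqnorm x = sqnorm x' by rewrite -!rdotxx /rdot (px x' x xx').
  by rewrite sqnormB -/(rdot x' h); lra.
have [p [ph pN _]] := riesz_relation N0 NL NC.
exists p; split=> //; apply: ncmap_ext => // m W u.
apply: coldot_ext => y.
have [k [kE kr]] := rH m W (adjmx u) y; have [k' [kE' kr']] := rL m W (adjmx u) y.
have kk' : pair k k'.
  split=> [|f g fg]; last by rewrite -kr -kr' fg.
  by apply: ncmap_ext => // n Z u'; rewrite kE kE'.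
have := kr h; have := kr' p; rewrite adjmxK => -> ->.
by rewrite dotpC -(pN k' (dotp k h)); [rewrite -dotpC|exists k].
Qed.

(** The inclusions in both directions are contractive, and injectivity of [fh_fun] makes them
    mutually inverse. *)
Lemma reproducing_isometry K H L :
  (forall h : H, graded_fun (fh_fun h)) -> (forall l : L, graded_fun (fh_fun l)) ->
  reproduces K H -> reproduces K L ->
  forall h : H, exists l : L, fh_fun l = fh_fun h /\ sqnorm l = sqnorm h.
Proof.
move=> gH gL rH rL h.
have [l [lh hl]] := reproducing_inclusion gH gL rH rL h.
have [h' [h'l lh']] := reproducing_inclusion gL gH rL rH l.
exists l; split=> //; apply/le_anti; rewrite hl /=.
by have -> : h = h' by apply: fh_inj; rewrite h'l lh.
Qed.

Lemma is_pullback_transfer K H L P (G : hilbertType R) (B : G -> H) :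
  (forall p : P, graded_fun (fh_fun p)) -> (forall l : L, graded_fun (fh_fun l)) ->
  reproduces K P -> reproduces K L -> is_pullback B P -> is_pullback B L.
Proof.
move=> gP gL rP rL [P1 P2]; split=> [l|g].
  have [p [pl _]] := reproducing_isometry gL gP rL rP l.
  by have [g gp] := P1 p; exists g; rewrite gp.
have [p [pg np]] := P2 g.
have [l [lp /eq_normC nl]] := reproducing_isometry gP gL rP rL p.
by exists l; rewrite lp nl.
Qed.

Section PullbackKernel.
Variables (G : hilbertType R) (H : fun_hilbert Om A Y) (B : G -> H).
Variables (L : fun_hilbert Om A Y).
Hypothesis bB : bounded_linear B.
Hypothesis pL : is_pullback B L.
Hypothesis gH : forall h : H, graded_fun (fh_fun h).

Lemma pullback_reproduces K :
  (forall m (W : Om m) (v : 'rV[A]_m) (y : 'cV[Y]_m), exists g : G,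
     (forall n (Z : Om n) (u : 'cV[A]_n),
        mxapp (fh_fun (B g) Z) u = mxapp (K n m Z W (mulcmx u v)) y) /\
     (forall f : G, coldot (mxapp (fh_fun (B f) W) (adjmx v)) y = dotp f g)) ->
  reproduces K L.
Proof.
move=> hK m W v y; have [g [gE gr]] := hK m W v y.
have [k [kg _]] := pL.2 g; exists k; split=> [n Z u|l]; first by rewrite kg gE.
have [f [fl hf]] := pullback_rel_ex bB pL l.
by rewrite -fl gr (pullback_dotp bB pL (conj fl hf) (esym kg)).
Qed.

Variable sigma : A -> G -> G.
Hypothesis rep : unital_star_rep sigma.
Hypothesis sigmaE : forall a g m (W : Om m) (v : 'rV[A]_m),
  mxapp (fh_fun (B (sigma a g)) W) (adjmx v) =
  mxapp (fh_fun (B g) W) (map_mx (fun x => cmul x a) (adjmx v)).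

Let sigma_ker a g : B g = 0 -> B (sigma a g) = 0.
Proof.
move=> Bg; apply/fh_inj/ncmap_ext => //  n Z u.
rewrite -(adjmxK u) sigmaE Bg; apply/matrixP => i j; rewrite !mxE.
by rewrite !big1 // => k _; rewrite (lin0 (fh_linear _ _ _)).
Qed.

(** [sigma a] preserves the complement of [Ker B] because its adjoint [sigma (star a)] preserves
    [Ker B]. *)
Let sigma_rel a (l l' : L) g :
  pullback_rel B l g -> fh_fun l' = fh_fun (B (sigma a g)) ->
  pullback_rel B l' (sigma a g).
Proof.
move=> [lg hg] l'g; split; [by rewrite l'g|move=> z Bz]; case: rep => _ _ _ adjS.
by rewrite -(starK a) adjS hg // /opker /= sigma_ker.
Qed.

(** [tau] is the restriction of [sigma] to the complement of [Ker B], transported to L by the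
    isometry [pullback_rel]. *)
Lemma pullback_star_rep : exists tau : A -> L -> L,
  unital_star_rep tau /\
  forall a (f : L) m (W : Om m) (v : 'rV[A]_m),
    mxapp (fh_fun (tau a f) W) (adjmx v) =
    mxapp (fh_fun f W) (map_mx (fun x => cmul x a) (adjmx v)).
Proof.
have /choice[q qP] := pullback_rel_ex bB pL.
have /choice[t tP] (al : A * L) : exists l' : L,
    pullback_rel B l' (sigma al.1 (q al.2)).
  have [l' [l'g _]] := pL.2 (sigma al.1 (q al.2)).
  by exists l'; apply: sigma_rel l'g; apply: qP.
case: rep => -[bS linS] S1 SM Sadj.
have lB := bB.1.
have relP (l l' : L) g : pullback_rel B l g -> pullback_rel B l' g -> l = l'.
  by move=> [lg _] [lg' _]; apply: fh_inj; rewrite -lg.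
have relI (l : L) g g' : pullback_rel B l g -> pullback_rel B l g' -> g = g'.
  move=> [lg hg] [lg' hg']; apply/subr0_eq/sqnorm_eq0; rewrite -rdotxx /rdot.
  rewrite (orthc_sub hg hg') // /opker /= (linB lB).
  by apply/eqP; rewrite subr_eq0; apply/eqP/fh_inj; rewrite lg.
have tS a (l : L) g : pullback_rel B l g -> pullback_rel B (t (a, l)) (sigma a g).
  by move=> lg; rewrite (relI _ _ _ lg (qP l)); apply: (tP (a, l)).
exists (fun a l => t (a, l)); split; last first.
  move=> a f m W v; have [<- _] := tP (a, f); rewrite sigmaE.
  by have [-> _] := qP f.
split.
- split=> [a|a x y].
    have lS := (bS a).1; apply/bounded_linearP; split=> [c l l'|].
      apply: (relP _ _ _ (tS _ _ _ (pullback_rel_lin bB c (qP l) (qP l')))).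
      by rewrite lS; apply: pullback_rel_lin => //; apply: tS; apply: qP.
    have /bounded_linearP[_ [c c0 Sc]] := bS a.
    exists c => // l; rewrite ler_rnorm //.
    rewrite (pullback_rel_sqnorm bB pL (tP (a, l))).
    rewrite (pullback_rel_sqnorm bB pL (qP l)).
    by rewrite -ler_rnorm.
  apply/funext => l; apply: (relP _ _ _ (tP (_, l))).
  rewrite /= linS; apply: (pullback_rel_lin bB a (tP (x, l)) (tP (y, l))).
- apply/funext => l; apply: (relP _ _ _ (tP (_, l))).
  by rewrite /= S1; apply: qP.
- move=> a b; apply/funext => l; apply: (relP _ _ _ (tP (_, l))).
  by rewrite /= SM; apply: tS; apply: tP (b, l).
- move=> a f g.
  rewrite (pullback_rel_dotp bB pL (tP (star a, f)) (qP g)).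
  by rewrite (pullback_rel_dotp bB pL (qP f) (tP (a, g))) Sadj.
Qed.

End PullbackKernel.

End ReproducingKernelSpaces.

(** * Kernels *)

Lemma mxappB (X : Type) (Y : zmodType) n m (T T' : 'M[X -> Y]_(n, m)) x :
  mxapp (T - T') x = mxapp T x - mxapp T' x.
Proof.
apply/matrixP => i j; rewrite !mxE -sumrB; apply: eq_bigr => k _.
by rewrite !mxE.
Qed.

Section OperatorMatrices.
Variables (R : realType) (X Y W : hilbertType R).

Definition mxbounded n m (T : 'M[X -> Y]_(n, m)) :=
  forall i j, bounded_linear (T i j).

Lemma adj_lincomb I (r : seq I) (P : pred I) (c : I -> R[i]) (T : I -> X -> Y) :
  (forall i, bounded_linear (T i)) ->
  adj (\sum_(i <- r | P i) c i *: T i) =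
  \sum_(i <- r | P i) Num.conj (c i) *: adj (T i).
Proof.
move=> bT; apply: adj_unique => x y.
rewrite !fct_sumE linear_sumr linear_sumlz; apply: eq_bigr => i _.
by rewrite /= dotpZl dotpZr conjCK dotp_adj.
Qed.

Lemma mxbounded_adj n m (T : 'M[X -> Y]_(n, m)) i j :
  mxbounded T -> bounded_linear (mxadj T i j).
Proof. by move=> bT; rewrite mxE; apply: bounded_linear_adj. Qed.

Lemma mxadj0 n m : mxadj (0 : 'M[X -> Y]_(n, m)) = 0.
Proof.
apply/matrixP => i j; rewrite !mxE; apply: adj_unique => x y.
by rewrite dotp0l dotp0r.
Qed.

Lemma mxadj_block n1 n2 m1 m2 (T11 : 'M[X -> Y]_(n1, m1))
    (T12 : 'M_(n1, m2)) (T21 : 'M_(n2, m1)) (T22 : 'M_(n2, m2)) :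
  mxadj (block_mx T11 T12 T21 T22) =
  block_mx (mxadj T11) (mxadj T21) (mxadj T12) (mxadj T22).
Proof.
apply/matrixP => i j; rewrite mxE.
by case: (split_ordP i) => k ->; case: (split_ordP j) => l ->;
  rewrite ?(block_mxEul, block_mxEur, block_mxEdl, block_mxEdr) mxE.
Qed.

Lemma mxadj_lact p n m (alpha : 'M_(p, n)) (T : 'M[X -> Y]_(n, m)) :
  mxbounded T -> mxadj (lact alpha T) = ract (mxadj T) (ctmx alpha).
Proof.
move=> bT; apply/matrixP => i j; rewrite !mxE adj_lincomb //.
by apply: eq_bigr => k _; rewrite !mxE.
Qed.

Lemma mxadj_ract n m q (T : 'M[X -> Y]_(n, m)) (beta : 'M_(m, q)) :
  mxbounded T -> mxadj (ract T beta) = lact (ctmx beta) (mxadj T).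
Proof.
move=> bT; apply/matrixP => i j; rewrite !mxE adj_lincomb //.
by apply: eq_bigr => k _; rewrite !mxE.
Qed.

Lemma coldot_mxadj n m (T : 'M[X -> Y]_(n, m)) x y : mxbounded T ->
  coldot (mxapp T x) y = coldot x (mxapp (mxadj T) y).
Proof.
move=> bT; rewrite /coldot.
under eq_bigr => i _ do rewrite mxE linear_sumlz.
under [RHS]eq_bigr => i _ do rewrite mxE linear_sumr.
rewrite exchange_big /=; apply: eq_bigr => j _; apply: eq_bigr => i _.
by rewrite !mxE dotp_adj.
Qed.

Lemma ract_lact p n m q (alpha : 'M_(p, n)) (T : 'M[X -> Y]_(n, m))
    (beta : 'M_(m, q)) :
  lact alpha (ract T beta) = ract (lact alpha T) beta.
Proof.
apply/matrixP => i j; rewrite !mxE.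
under eq_bigr => k _ do rewrite mxE scaler_sumr.
under [RHS]eq_bigr => k _ do rewrite mxE scaler_sumr.
rewrite exchange_big /=; apply: eq_bigr => k _; apply: eq_bigr => l _.
by rewrite !scalerA mulrC.
Qed.

Lemma lactB p n m (alpha : 'M_(p, n)) (T T' : 'M[X -> Y]_(n, m)) :
  lact alpha (T - T') = lact alpha T - lact alpha T'.
Proof.
apply/matrixP => i j; rewrite !mxE -sumrB; apply: eq_bigr => k _.
by rewrite !mxE scalerBr.
Qed.

Lemma ractB n m q (beta : 'M_(m, q)) (T T' : 'M[X -> Y]_(n, m)) :
  ract (T - T') beta = ract T beta - ract T' beta.
Proof.
apply/matrixP => i j; rewrite !mxE -sumrB; apply: eq_bigr => k _.
by rewrite !mxE scalerBr.
Qed.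

End OperatorMatrices.

Section OperatorMatrixProducts.
Variables (R : realType) (X : Type) (Y W : hilbertType R).

Lemma mxcomp_block n1 n2 k1 k2 m1 m2
    (T11 : 'M[Y -> W]_(n1, k1)) (T12 : 'M_(n1, k2))
    (T21 : 'M_(n2, k1)) (T22 : 'M_(n2, k2))
    (V11 : 'M[X -> Y]_(k1, m1)) (V12 : 'M_(k1, m2))
    (V21 : 'M_(k2, m1)) (V22 : 'M_(k2, m2)) :
  mxcomp (block_mx T11 T12 T21 T22) (block_mx V11 V12 V21 V22) =
  block_mx (mxcomp T11 V11 + mxcomp T12 V21) (mxcomp T11 V12 + mxcomp T12 V22)
           (mxcomp T21 V11 + mxcomp T22 V21) (mxcomp T21 V12 + mxcomp T22 V22).
Proof.
apply/matrixP => i j; rewrite mxE; apply/funext => x; rewrite big_split_ord /=.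
by case: (split_ordP i) => k ->; case: (split_ordP j) => l ->;
  rewrite ?(block_mxEul, block_mxEur, block_mxEdl, block_mxEdr) !mxE;
  congr (_ + _); apply: eq_bigr => a _;
  rewrite ?(block_mxEul, block_mxEur, block_mxEdl, block_mxEdr).
Qed.

Lemma mxcomp0l n k m (V : 'M[X -> Y]_(k, m)) :
  mxcomp (0 : 'M[Y -> W]_(n, k)) V = 0.
Proof.
apply/matrixP => i j; rewrite !mxE; apply/funext => x.
by rewrite big1 // => l _; rewrite mxE.
Qed.

Lemma lact_mxcomp p n k m (alpha : 'M_(p, n)) (T : 'M[Y -> W]_(n, k))
    (V : 'M[X -> Y]_(k, m)) :
  lact alpha (mxcomp T V) = mxcomp (lact alpha T) V.
Proof.
apply/matrixP => i j; rewrite !mxE; apply/funext => x; rewrite fct_sumE.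
under eq_bigr => a _ do rewrite mxE scalrfctE /= scaler_sumr.
under [RHS]eq_bigr => l _ do rewrite mxE fct_sumE.
by rewrite exchange_big.
Qed.

Section Bounded.
Variables (n k : nat) (T : 'M[Y -> W]_(n, k)).
Hypothesis bT : mxbounded T.

Let lT i j : linear (T i j) := (bT i j).1.

Lemma mxcomp0r m : mxcomp T (0 : 'M[X -> Y]_(k, m)) = 0.
Proof.
apply/matrixP => i j; rewrite !mxE; apply/funext => x.
by rewrite big1 // => l _; rewrite mxE (lin0 (lT _ _)).
Qed.

Lemma mxcompDr m (c : R[i]) (V V' : 'M[X -> Y]_(k, m)) :
  mxcomp T (map_mx ( *:%R c) V + V') =
  map_mx ( *:%R c) (mxcomp T V) + mxcomp T V'.
Proof.
apply/matrixP => i j; rewrite !mxE; apply/funext => x.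
rewrite addrfctE scalrfctE /= scaler_sumr -big_split /=; apply: eq_bigr => l _.
by rewrite !mxE /= lT.
Qed.

Lemma ract_mxcomp m q (V : 'M[X -> Y]_(k, m)) (beta : 'M_(m, q)) :
  ract (mxcomp T V) beta = mxcomp T (ract V beta).
Proof.
apply/matrixP => i j; rewrite !mxE; apply/funext => x; rewrite fct_sumE.
under eq_bigr => a _ do rewrite mxE scalrfctE /= scaler_sumr.
under [RHS]eq_bigr => l _ do rewrite mxE fct_sumE (lin_sum (lT _ _)).
rewrite exchange_big /=; apply: eq_bigr => l _; apply: eq_bigr => a _.
by rewrite (linZ (lT _ _)).
Qed.

Lemma mxcomp_ract p m (beta : 'M_(k, p)) (V : 'M[X -> Y]_(p, m)) :
  mxcomp (ract T beta) V = mxcomp T (lact beta V).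
Proof.
apply/matrixP => i j; rewrite !mxE; apply/funext => x.
under eq_bigr => l _ do rewrite mxE fct_sumE.
under [RHS]eq_bigr => l _ do rewrite mxE fct_sumE (lin_sum (lT _ _)).
rewrite exchange_big /=; apply: eq_bigr => l _; apply: eq_bigr => a _.
by rewrite (linZ (lT _ _)).
Qed.

Lemma mxapp_comp m (V : 'M[X -> Y]_(k, m)) x :
  mxapp (mxcomp T V) x = mxapp T (mxapp V x).
Proof.
apply/matrixP => i j; rewrite !mxE.
under eq_bigr => l _ do rewrite mxE.
under [RHS]eq_bigr => l _ do rewrite mxE (lin_sum (lT _ _)).
by rewrite exchange_big.
Qed.

End Bounded.

End OperatorMatrixProducts.

Lemma mxcompDl (R : realType) (X Y W : hilbertType R) n k m (c : R[i])
    (T T' : 'M[Y -> W]_(n, k)) (V : 'M[X -> Y]_(k, m)) :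
  mxcomp (map_mx ( *:%R c) T + T') V =
  map_mx ( *:%R c) (mxcomp T V) + mxcomp T' V.
Proof.
apply/matrixP => i j; rewrite !mxE; apply/funext => x.
rewrite addrfctE scalrfctE /= scaler_sumr -big_split /=; apply: eq_bigr => l _.
by rewrite !mxE.
Qed.

Lemma mxbounded_comp (R : realType) (X Y W : hilbertType R) n k m
    (T : 'M[Y -> W]_(n, k)) (V : 'M[X -> Y]_(k, m)) :
  mxbounded T -> mxbounded V -> mxbounded (mxcomp T V).
Proof.
move=> bT bV i j; rewrite mxE.
rewrite (_ : (fun x => _) = \sum_l (T i l \o V l j)).
  by apply: bounded_linear_sum => l; apply: bounded_linear_comp.
by apply/funext => x; rewrite fct_sumE.
Qed.

Section SandwichedKernel.
Variables (R : realType).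

Lemma graded_kernelB (T : Type) (Om : ncsubset T) (A : normedModType R[i])
    (Y : hilbertType R) (K K0 : nckmap Om A Y) :
  graded_kernel K -> graded_kernel K0 ->
  graded_kernel (fun n m Z W P => K n m Z W P - K0 n m Z W P).
Proof.
move=> gK gK0 n m Z W; have [lK bK] := gK n m Z W; have [lK0 bK0] := gK0 n m Z W.
split=> [c P P'|P i j]; last first.
  by rewrite !mxE; apply: bounded_linearD => //; apply: bounded_linearN.
rewrite lK lK0; apply/matrixP => i j; rewrite !mxE.
by rewrite opprD addrACA scalerBr.
Qed.

Lemma gnc_kernelB (s : nc_setting R) (Om : ncsubset (base_set s))
    (A : normedModType R[i]) (Y : hilbertType R) (K K0 : nckmap Om A Y) :
  gnc_kernel K -> gnc_kernel K0 ->
  gnc_kernel (fun n m Z W P => K n m Z W P - K0 n m Z W P).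
Proof.
move: Om K K0; case: s => [T z|V] Om K K0 [gK hK] [gK0 hK0] /=.
  split; first exact: graded_kernelB.
  move=> n n' m m' Z Z' W W' ZZ WW hZ hW P11 P12 P21 P22.
  rewrite (hK _ _ _ _ _ _ _ _ _ _ hZ hW) (hK0 _ _ _ _ _ _ _ _ _ _ hZ hW).
  by rewrite opp_block_mx add_block_mx.
split; first exact: graded_kernelB.
move=> n n' m m' Z Z' W W' alpha beta hZ hW P.
rewrite ractB lactB (hK _ _ _ _ _ _ _ _ _ _ hZ hW).
by rewrite (hK0 _ _ _ _ _ _ _ _ _ _ hZ hW).
Qed.

Lemma graded_KS0 (s : nc_setting R) (Om : ncsubset (base_set s))
    (A : cstarType R) (U Y : hilbertType R) (K' : nckmap Om A U)
    (S : ncmap Om U Y) :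
  graded_fun S -> graded_kernel K' -> graded_kernel (KS0 K' S).
Proof.
move=> gS gK n m Z W; have [lK bK] := gK n m Z W.
split=> [c P P'|P i j].
  by rewrite /KS0 lK mxcompDr ?mxcompDl //; apply: gS.
apply: mxbounded_comp; first by apply: mxbounded_comp; [apply: gS|apply: bK].
by move=> k l; apply: mxbounded_adj; apply: gS.
Qed.

(** In the global case both outer factors are block diagonal, so each block of the product meets one
    block of [K']. In the nc case alpha moves through [S(Z)] and the adjoint of beta through that of
    [S(W)]. *)
Lemma gnc_KS0 (s : nc_setting R) (Om : ncsubset (base_set s))
    (A : cstarType R) (U Y : hilbertType R) (K' : nckmap Om A U)
    (S : ncmap Om U Y) :
  gnc_fun S -> gnc_kernel K' -> gnc_kernel (KS0 K' S).
Proof.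
move: Om K' S; case: s => [T z|V] Om K' S [gS hS] [gK hK] /=.
  split; first exact: (@graded_KS0 (GlobalCase R z)).
  move=> n n' m m' Z Z' W W' ZZ WW hZ hW P11 P12 P21 P22; rewrite /KS0.
  rewrite (hK _ _ _ _ _ _ _ _ _ _ hZ hW) (hS _ _ _ _ _ hZ) (hS _ _ _ _ _ hW).
  rewrite mxadj_block !mxadj0 !mxcomp_block !mxcomp0l !addr0 !add0r.
  rewrite !mxcomp0r ?addr0 ?add0r //; apply: mxbounded_comp;
  first [exact: gS | exact: (gK _ _ _ _).2].
split; first exact: (@graded_KS0 (NcCase V)).
move=> n n' m m' Z Z' W W' alpha beta hZ hW P; rewrite /KS0.
have bS k (Q : Om k) : mxbounded (S k Q) by apply: gS.
have bK k l (Q : Om k) (Q' : Om l) P' : mxbounded (K' k l Q Q' P').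
  exact: (gK _ _ _ _).2.
rewrite -(hK _ _ _ _ _ _ _ _ _ _ hZ hW) ract_mxcomp; last exact: mxbounded_comp.
rewrite lact_mxcomp lact_mxcomp (hS _ _ _ _ _ hZ) mxcomp_ract //.
(* The adjoint of the intertwining relation of S: [S(W)^* beta^* = beta^* S(W')^*]. *)
rewrite -mxadj_lact // (hS _ _ _ _ _ hW) mxadj_ract // -[LHS]mxcomp_ract.
  by rewrite ract_mxcomp // ract_lact.
apply: mxbounded_comp => // i j; rewrite mxE; apply: bounded_linear_sum => k.
by apply: bounded_linearZ; apply: bK.
Qed.

End SandwichedKernel.

(** * Complements and multipliers *)

Section BrangesianComplement.
Variables (R : realType) (G H : hilbertType R) (M : G -> H) (D : H -> H).
Hypothesis bM : bounded_linear M.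
Hypothesis bD : bounded_linear D.
Hypothesis symD : forall x y, dotp (D x) y = dotp x (D y).
Hypothesis DD : forall x, D (D x) = x - M (adj M x).

Let lD := bD.1.

Let sqnorm_adj x : sqnorm (D x) + sqnorm (adj M x) = sqnorm x.
Proof.
have -> : sqnorm (D x) = rdot x (D (D x)) by rewrite -rdotxx /rdot symD.
have -> : sqnorm (adj M x) = rdot (M (adj M x)) x.
  by rewrite -rdotxx /rdot -dotp_adj.
by rewrite DD rdotDr rdotNr rdotxx (rdotC x) subrK.
Qed.

(* [D M] has the isometric adjoint [x |-> (D x, M^* x)], hence is a
   contraction. *)
Lemma sqnorm_defect_row d g : sqnorm (D d + M g) <= sqnorm d + sqnorm g.
Proof.
set x := D d + M g.
have := sqnorm_ge0 (d - D x); have := sqnorm_ge0 (g - adj M x).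
rewrite !sqnormB; have := sqnorm_adj x.
have : rdot d (D x) + rdot g (adj M x) = sqnorm x.
  by rewrite /rdot -symD -dotp_adj // -raddfD -dotpDl -[sqnorm x]rdotxx.
by lra.
Qed.

(** The Riesz vector p of [<., d>] on the range of D is the projection of d onto the closure of that
    range. Symmetry gives [D (d - p) = 0], while d and p are both orthogonal to [Ker D], so
    [d = p]. *)
Lemma range_dense d (e : R) : orthc (opker D) d -> 0 < e ->
  exists x, rnorm (d - D x) < e.
Proof.
move=> hd e0; pose N x c := exists2 z, x = D z & c = dotp x d.
have N0 : N 0 0 by exists 0; rewrite ?(lin0 lD) ?dotp0l.
have NL a x c x' c' : N x c -> N x' c' -> N (a *: x + x') (a * c + c').
  move=> [z -> ->] [z' -> ->]; exists (a *: z + z'); first by rewrite lD.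
  by rewrite dotpDl dotpZl.
have NC x c : N x c -> 2 * complex.Re c <= sqnorm d + sqnorm x.
  move=> [_ _ ->]; have := sqnorm_ge0 (x - d).
  by rewrite sqnormB -/(rdot x d); lra.
have [p [_ pN clp]] := riesz_relation N0 NL NC.
suff -> : d = p.
  by have [_ [c [[x -> _] px]]] := clp _ e0; exists x.
have Dp : D (d - p) = 0.
  apply: dotp_ext => z; rewrite -symD dotpBr -(pN _ (dotp (D z) d)).
    by rewrite subrr dotp0r.
  by exists z.
have hp : orthc (opker D) p.
  move=> z Dz; apply: dotp_adherent0 => e' e'0.
  have [_ [c [[x -> _] px]]] := clp _ e'0.
  by exists (D x); rewrite symD Dz dotp0r.
by apply/subr0_eq/sqnorm_eq0; rewrite -rdotxx /rdot (orthc_sub hd hp).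
Qed.

(* For [g = M^* x] the value is at least |d|^2 - |d - D x|^2. *)
Lemma sqnorm_defect_row_sharp d (e : R) : orthc (opker D) d -> 0 < e ->
  exists g, sqnorm d - e <= sqnorm (D d + M g) - sqnorm g.
Proof.
move=> hd e0; have e1 : 0 < Num.sqrt e by rewrite sqrtr_gt0.
have [x dx] := range_dense hd e1.
exists (adj M x); set w := d - D x.
have we : sqnorm w <= e.
  by rewrite sqnormE -(sqr_sqrtr (ltW e0)) ler_sqr ?nnegrE ?sqrtr_ge0 ?rnorm_ge0 // ltW.
(* Since [D d = D (D x) + D w], the two terms [M M^* x] cancel. *)
have -> : D d + M (adj M x) = x + D w.
  by rewrite /w (linB lD) DD opprB [RHS]addrCA subrKC.
have := sqnorm_adj x; have := sqnorm_ge0 (D w).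
have : sqnorm d = sqnorm (D x) + 2 * rdot x (D w) + sqnorm w.
  by rewrite -[d](subrKC (D x)) sqnormD /rdot symD.
by rewrite sqnormD; lra.
Qed.

(** With [g = M^* z] the hypothesis yields [2 Re <z, h> <= C + |D z|^2], so [D z |-> <z, h>] is
    represented by some p, and [<D z, p> = <z, h>] means [h = D p]. As [D z] need not determine z,
    this assignment enters as a relation. *)
Lemma bounded_defect_range h (C : R) :
  (forall g, sqnorm (h + M g) - sqnorm g <= C) -> exists p, h = D p.
Proof.
move=> hC; pose N x c := exists2 z, x = D z & c = dotp z h.
have N0 : N 0 0 by exists 0; rewrite ?(lin0 lD) ?dotp0l.
have NL a x c x' c' : N x c -> N x' c' -> N (a *: x + x') (a * c + c').
  move=> [z -> ->] [z' -> ->]; exists (a *: z + z'); first by rewrite lD.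
  by rewrite dotpDl dotpZl.
have NC x c : N x c -> 2 * complex.Re c <= C + sqnorm x.
  move=> [z -> ->]; rewrite -/(rdot z h).
  have := hC (adj M z); have := sqnorm_adj z; have := sqnorm_ge0 (h - D (D z)).
  have -> : h + M (adj M z) = (h - D (D z)) + z.
    by rewrite DD opprB -addrA subrK.
  rewrite (sqnormD (h - D (D z))) rdotDl rdotNl.
  have -> : rdot (D (D z)) z = sqnorm (D z) by rewrite -rdotxx /rdot symD.
  by rewrite (rdotC h); lra.
have [p [_ pN _]] := riesz_relation N0 NL NC.
exists p; apply: dotp_ext => z; rewrite -symD.
by apply: pN; exists z.
Qed.

End BrangesianComplement.

Lemma gnc_kernel_graded (R : realType) (s : nc_setting R)
    (Om : ncsubset (base_set s)) (A Y : normedModType R[i]) (K : nckmap Om A Y) :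
  gnc_kernel K -> graded_kernel K.
Proof. by move: Om K; case: s => [T z|V] Om K []. Qed.

Lemma graded_kernel_sum (R : realType) (T : Type) (Om : ncsubset T)
    (A Y : normedModType R[i]) (K : nckmap Om A Y) n m (Z : Om n) (W : Om m)
    I (r : seq I) (P : pred I) (E : I -> 'M[A]_(n, m)) :
  graded_kernel K ->
  K n m Z W (\sum_(i <- r | P i) E i) = \sum_(i <- r | P i) K n m Z W (E i).
Proof.
move=> gK; have [lK _] := gK n m Z W.
have KD Q Q' : K n m Z W (Q + Q') = K n m Z W Q + K n m Z W Q'.
  have id1 (V : lmodType R[i]) (B : 'M[V]_(n, m)) : map_mx ( *:%R 1) B = B.
    by apply/matrixP => i j; rewrite mxE scale1r.
  by have := lK 1 Q Q'; rewrite !id1.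
apply: big_morph => //.
by apply: (addrI (K n m Z W 0)); rewrite -KD !addr0.
Qed.

(** * The kernels and spaces attached to a contractive multiplier *)

Section Multiplier.
Variables (R : realType) (s : nc_setting R) (Om : ncsubset (base_set s)).
Local Arguments Om : clear implicits.
Variables (A : cstarType R) (U Y : hilbertType R).
Variables (K' : nckmap Om A U) (K : nckmap Om A Y) (S : ncmap Om U Y).
Local Arguments S : clear implicits.
Local Arguments K' : clear implicits.
Variables (HK' : fun_hilbert Om A U) (HK : fun_hilbert Om A Y) (M : HK' -> HK).
Hypothesis K'cp : cp_kernel K'.
Hypothesis Kcp : cp_kernel K.
Hypothesis rK' : is_rkhs K' HK'.
Hypothesis rK : is_rkhs K HK.
Hypothesis gS : gnc_fun S.
Hypothesis cM : contractive_multiplier S M.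

Let bS n (Z : Om n) : mxbounded (S n Z).
Proof. exact: (gnc_graded gS). Qed.

Let gHK (h : HK) : graded_fun (fh_fun h).
Proof. by apply: gnc_graded; case: rK. Qed.

Lemma mxapp_multiplier f n (W : Om n) u :
  mxapp (fh_fun (M f) W) u = mxapp (S n W) (mxapp (fh_fun f W) u).
Proof. by rewrite cM.1 mxapp_comp. Qed.

Lemma bounded_multiplier : bounded_linear M.
Proof.
split; last by exists 1 => f; rewrite mul1r cM.2.
move=> a f g; apply: fh_inj; apply: functional_extensionality_dep => n.
apply: functional_extensionality_dep => Z; apply/matrixP => i j.
rewrite fh_linear !cM.1 !mxE; apply/funext => x.
rewrite addrfctE scalrfctE /= scaler_sumr -big_split /=; apply: eq_bigr => l _.
by rewrite fh_linear (bS _ _ _).1.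
Qed.

Let bM := bounded_multiplier.

Let M1 f : sqnorm (M f) <= sqnorm f.
Proof. by rewrite -normC_le cM.2. Qed.

Let adjM1 h : sqnorm (adj M h) <= sqnorm h.
Proof.
rewrite -[leRHS]mul1r -(expr1n _ 2) -ler_rnorm //; apply: rnorm_adj => // f.
by rewrite ler_rnorm // expr1n mul1r.
Qed.

Lemma multiplier_kernel m (W : Om m) (v : 'rV[A]_m) (y : 'cV[Y]_m) :
  exists g : HK',
    (forall n (Z : Om n) (u : 'cV[A]_n),
       mxapp (fh_fun (M g) Z) u = mxapp (KS0 K' S Z W (mulcmx u v)) y) /\
    (forall f, coldot (mxapp (fh_fun (M f) W) (adjmx v)) y = dotp f g).
Proof.
have [_ repK' _] := rK'; have [gK' _] := K'cp.
have [g [gE gr]] := repK' m W v (mxapp (mxadj (S m W)) y).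
exists g; split=> [n Z u|f]; last by rewrite mxapp_multiplier coldot_mxadj.
have bK' : mxbounded (K' n m Z W (mulcmx u v)).
  exact: (gnc_kernel_graded gK' Z W).2.
rewrite mxapp_multiplier gE /KS0 mxapp_comp ?mxapp_comp //.
exact: mxbounded_comp.
Qed.

Lemma defect_kernel m (W : Om m) (v : 'rV[A]_m) (y : 'cV[Y]_m) :
  exists k : HK,
    (forall n (Z : Om n) (u : 'cV[A]_n),
       mxapp (fh_fun (k - M (adj M k)) Z) u =
       mxapp (KS K K' S Z W (mulcmx u v)) y) /\
    (forall f : HK, coldot (mxapp (fh_fun f W) (adjmx v)) y = dotp f k).
Proof.
have [_ repK _] := rK; have [k [kE kr]] := repK m W v y.
have [g [gE gr]] := multiplier_kernel W v y.
exists k; split=> // n Z u.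
(* Both vectors represent the same evaluation of [M f] at W. *)
have -> : adj M k = g by apply: dotp_ext => f; rewrite -dotp_adj // -kr gr.
rewrite /KS mxappB -kE -gE -mxappB; congr (mxapp _ u).
by apply/matrixP => i j; rewrite (linB (fh_linear _ _ _)) !mxE.
Qed.

Lemma cp_KS0 : cp_kernel (KS0 K' S).
Proof.
have [gK' pK'] := K'cp; split; first exact: gnc_KS0.
move=> n Z P hP y.
have bK' : mxbounded (K' n n Z Z P) by exact: (gnc_kernel_graded gK' Z Z).2.
rewrite /KS0 mxapp_comp ?mxapp_comp //; last exact: mxbounded_comp.
by rewrite coldot_mxadj //; apply: pK'.
Qed.

Lemma defect_dotp_ge0 (k : HK) : 0 <= dotp (k - M (adj M k)) k.
Proof.
rewrite dotpBl dotp_adj // !dotpxx -rmorphB /= ler0c subr_ge0.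
exact: adjM1.
Qed.

(** [X^* X] is the sum, over the rows of X, of the adjoint of the row times the row. Each term
    contributes [<k - M M^* k, k>] for a kernel function k of [K], which is nonnegative as M is a
    contraction. *)
Lemma cp_KS : cp_kernel (KS K K' S).
Proof.
have [gK' _] := K'cp; have [gK _] := Kcp.
have gKS : gnc_kernel (KS K K' S) by apply: gnc_kernelB => //; apply: gnc_KS0.
split=> // n Z P [X ->] y.
have -> : mulcmx (adjmx X) X = \sum_i mulcmx (adjmx (row i X)) (row i X).
  apply/matrixP => i j; rewrite summxE !mxE; apply: eq_bigr => k _.
  by rewrite !mxE big_ord1 !mxE.
rewrite (graded_kernel_sum _ _ _ _ _ (gnc_kernel_graded gKS)).
pose E i := KS K K' S Z Z (mulcmx (adjmx (row i X)) (row i X)).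
rewrite -/(\sum_i E i).
have -> : coldot (mxapp (\sum_i E i) y) y = \sum_i coldot (mxapp (E i) y) y.
  rewrite /coldot exchange_big /=; apply: eq_bigr => j _.
  rewrite -linear_sumlz; congr (dotp _ _); rewrite mxE.
  under [RHS]eq_bigr => i _ do rewrite mxE.
  rewrite exchange_big /=; apply: eq_bigr => l _.
  by rewrite summxE fct_sumE.
apply: sumr_ge0 => i _.
have [k [kE kr]] := defect_kernel Z (row i X) y.
by rewrite -kE kr; apply: defect_dotp_ge0.
Qed.

Let T (h : HK) := M (adj M h).

Let lT : linear T.
Proof. by move=> a x y; rewrite /T (linear_adj bM) bM.1. Qed.

Let T1 x : rnorm (T x) <= rnorm x.
Proof.
rewrite -[leRHS]mul1r ler_rnorm // expr1n mul1r.
exact: le_trans (M1 _) (adjM1 _).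
Qed.

Let symT x y : dotp (T x) y = dotp x (T y).
Proof. by rewrite /T dotp_adj // dotpC -dotp_adj // -dotpC. Qed.

(** [psqrt] defaults to 0 if there is no root; [exists_psqrt] for the operator [M M^*] excludes
    this. Symmetry comes from positivity. *)
Lemma defectP : [/\ bounded_linear (defect M),
  forall x y, dotp (defect M x) y = dotp x (defect M y) &
  forall x, defect M (defect M x) = x - M (adj M x)].
Proof.
have [D0 [bD0 pD0 DD0 _]] := exists_psqrt lT T1 symT.
have D0P : [set D : HK -> HK | [/\ bounded_linear D, forall x, 0 <= dotp (D x) x &
    D \o D = (fun h => h - M (adj M h))]] D0.
  by split=> //; apply/funext => x; apply: DD0.
have [bD pD DD] := xgetPex (fun=> 0) (ex_intro _ _ D0P).
split=> // [|x]; first by apply: positive_symmetric pD; case: bD.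
exact: (congr1 (@^~ x) DD).
Qed.

Lemma defect_reproduces (D : HK -> HK) (L : fun_hilbert Om A Y) :
  bounded_linear D -> (forall x y, dotp (D x) y = dotp x (D y)) ->
  (forall x, D (D x) = x - M (adj M x)) -> is_pullback D L ->
  reproduces (KS K K' S) L.
Proof.
move=> bD symD DD pL; apply: (pullback_reproduces bD pL) => m W v y.
have [k [kE kr]] := defect_kernel W v y.
exists (D k); split=> [n Z u|f]; first by rewrite DD kE.
by rewrite kr symD.
Qed.

Lemma pullback_gnc (G : hilbertType R) (B : G -> HK) (L : fun_hilbert Om A Y) :
  is_pullback B L -> forall l : L, gnc_fun (fh_fun l).
Proof. by move=> pL l; have [g <-] := pL.1 l; case: rK. Qed.

(** The root is taken from [exists_psqrt] for its commutation property: the representation on [HK]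
    commutes with [M M^*], hence with D, and so passes to the range of D. *)
Lemma exists_rkhs_KS :
  exists HKS : fun_hilbert Om A Y, is_rkhs (KS K K' S) HKS.
Proof.
have [D [bD pD DD commD]] := exists_psqrt lT T1 symT.
have symD := positive_symmetric bD.1 pD.
have pL := pullback_spaceP bD.
have [_ _ [sg [sg_rep sgE]]] := rK; have [_ _ [sg' [sg'_rep sg'E]]] := rK'.
(* The representations act on the argument of a function, the multiplier on its value. *)
have sgM a f : sg a (M f) = M (sg' a f).
  apply/fh_inj/ncmap_ext => // n Z u; rewrite -(adjmxK u).
  by rewrite sgE !mxapp_multiplier sg'E.
(* Taking adjoints in [sgM] at [star a] gives the same relation for [M^*]. *)
have sgT a x : sg a (T x) = T (sg a x).
  rewrite /T sgM; congr M; apply: dotp_ext => z.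
  have [_ _ _ adjS] := sg_rep; have [_ _ _ adjS'] := sg'_rep.
  by rewrite -adjS' -!dotp_adj // -adjS sgM.
exists (pullback_space bD); split; first exact: pullback_gnc pL.
  exact: defect_reproduces pL.
apply: (pullback_star_rep bD pL gHK sg_rep) => a g m W v.
by rewrite -commD // ?sgE //; case: sg_rep => -[].
Qed.

(** The concrete range space of the defect operator has kernel [KS K K' S], and the pull-back
    property passes to every space with this kernel. *)
Lemma rkhs_KS_pullback (HKS : fun_hilbert Om A Y) :
  is_rkhs (KS K K' S) HKS -> is_pullback (defect M) HKS.
Proof.
have [bD symD DD] := defectP; have pL := pullback_spaceP bD.
move=> [gHKS repHKS _]; apply: (is_pullback_transfer _ _ _ repHKS pL).
- by move=> l; apply: gnc_graded; apply: pullback_gnc pL l.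
- by move=> l; apply: gnc_graded.
- exact: defect_reproduces pL.
Qed.

Lemma multiplier_range_rkhs (L : fun_hilbert Om A Y) :
  is_pullback M L -> contractively_included L HK /\ is_rkhs (KS0 K' S) L.
Proof.
move=> pL; split=> [l|].
  have [g lg] := pullback_rel_ex bM pL l; exists (M g); split; first by case: lg.
  by rewrite normC_le (pullback_rel_sqnorm bM pL lg).
split; first exact: pullback_gnc pL.
  exact: pullback_reproduces bM pL _ multiplier_kernel.
have [_ _ [sg' [sg'_rep sg'E]]] := rK'.
apply: (pullback_star_rep bM pL gHK sg'_rep) => a g m W v.
by rewrite !mxapp_multiplier sg'E.
Qed.

Lemma defect_brangesian (L HKS : fun_hilbert Om A Y) :
  is_pullback M L -> is_pullback (defect M) HKS ->
  is_brangesian_complement L HK HKS.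
Proof.
have [bD symD DD] := defectP; move=> pL pD.
(* The norm in L is that of the projection of g, hence at most [|g|], so the supremum over L
   dominates the value at every g. *)
have val_ge h g : ((sqnorm (h + M g) - sqnorm g)%:E <= brangesian_sqnorm L h)%E.
  have [l [lg /eq_normC nl]] := pL.2 g.
  apply: (@le_trans _ _ (sqnorm (h + M g) - sqnorm l)%:E).
    by rewrite lee_fin lerD2l lerN2 nl sqnorm_orthproj.
  by apply: ereal_sup_ubound; exists l, (M g).
have valE (b : HKS) (h : HK) : fh_fun b = fh_fun h ->
    (sqnorm b)%:E = brangesian_sqnorm L h.
  move=> bh; have [d db] := pullback_rel_ex bD pD b.
  rewrite (pullback_rel_sqnorm bD pD db).
  have -> : h = defect M d by apply: fh_inj; rewrite -bh; case: db.
  (* The supremum is at most [|d|^2] by contractivity of the row [[D M]], and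
     [sqnorm_defect_row_sharp] comes within e of this value. *)
  apply/le_anti/andP; split; last first.
    apply: ge_ereal_sup => _ [l [l' [l'l ->]]]; rewrite lee_fin.
    have [g lg] := pullback_rel_ex bM pL l.
    have -> : l' = M g by apply: fh_inj; rewrite l'l; case: lg.
    rewrite (pullback_rel_sqnorm bM pL lg) lerBlDr.
    exact: sqnorm_defect_row.
  apply/lee_addgt0Pr => e e0.
  have [g hg] := sqnorm_defect_row_sharp bM bD symD DD db.2 e0.
  apply: (@le_trans _ _ ((sqnorm (defect M d + M g) - sqnorm g)%:E + e%:E)%E).
    by rewrite -EFinD lee_fin -lerBlDr.
  by rewrite leeD2r.
split=> [b|h|//]; first by have [h hb] := pD.1 b; exists (defect M h).
split=> [fin|[b bh]]; last by rewrite -(valE b h bh) ltry.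
have [p hp] : exists p, h = defect M p.
  (* A real supremum bounds all values and puts h in the range; minus infinity is excluded by the
     value at [g = 0]. *)
  case E : (brangesian_sqnorm L h) fin => [r| |] // _.
    apply: (bounded_defect_range bM bD symD DD (C := r)) => g.
    by rewrite -lee_fin -E; apply: val_ge.
  by have := val_ge h 0; rewrite E.
by have [b [bp _]] := pD.2 p; exists b; rewrite bp hp.
Qed.

End Multiplier.

Theorem theorem4p4 (R : realType) (s : nc_setting R)
    (Om : ncsubset (base_set s))
    (A : cstarType R) (U Y : hilbertType R)
    (K' : nckmap Om A U) (K : nckmap Om A Y) (S : ncmap Om U Y)
    (HK' : fun_hilbert Om A U) (HK : fun_hilbert Om A Y) (MS : HK' -> HK) :
  nc_set Om ->
  cp_kernel K' -> cp_kernel K ->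
  is_rkhs K' HK' -> is_rkhs K HK ->
  gnc_fun S -> contractive_multiplier S MS ->
  [/\ cp_kernel (KS K K' S),
      (* H(K_S) is the pull-back space Ran (I - M_S M_S^* )^(1/2) *)
      (exists HKS : fun_hilbert Om A Y, is_rkhs (KS K K' S) HKS) /\
      (forall HKS : fun_hilbert Om A Y, is_rkhs (KS K K' S) HKS ->
         is_pullback (defect MS) HKS),
      (* the space M_{M_S} exists and is the RKHS with kernel K_S^0 *)
      (exists M : fun_hilbert Om A Y, is_pullback MS M) /\
      (forall M : fun_hilbert Om A Y, is_pullback MS M ->
         contractively_included M HK /\
         cp_kernel (KS0 K' S) /\ is_rkhs (KS0 K' S) M) &
      (* H(K_S) is the Brangesian complement of M_{M_S} *)
      forall M HKS : fun_hilbert Om A Y,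
        is_pullback MS M -> is_rkhs (KS K K' S) HKS ->
        is_brangesian_complement M HK HKS].
Proof.
move=> _ K'cp Kcp rK' rK gS cM; split.
- exact: cp_KS rK gS cM.
- split; first exact: exists_rkhs_KS cM.
  by move=> HKS; apply: rkhs_KS_pullback.
- split.
    by exists (pullback_space (bounded_multiplier gS cM)); apply: pullback_spaceP.
  move=> M pM; have [inc rM] := multiplier_range_rkhs K'cp rK' rK gS cM pM.
  by do 2!split => //; apply: cp_KS0.
- move=> M HKS pM rS; apply: (defect_brangesian gS cM pM).
  exact: rkhs_KS_pullback rS.
Qed.
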